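(* Let $\tilde\omega$ be the Kähler form on $\mathbb C^2$ with Kähler potential $\Phi(z,w)=\exp\left(\frac14|z|^2-\frac{\sqrt{-1}}4(w-\bar w)\right)$, and let $F\colon\mathbb C^2\to\ell^2(\mathbb C)$ be a Kähler map, i.e. a holomorphic map with $F^*\omega_0=\tilde\omega$. Let $M=\Gamma\backslash(\mathrm{Heis}(3;\mathbb R)\times\mathbb R)$ be a primary Kodaira surface, with universal cover identified with $\mathbb C^2$ via the holomorphic coordinates $(z,w)$, endowed with its Vaisman lcK metric $\omega$. Then $F$ does not induce any lcK map $f\colon M\to H^\infty_\lambda$ into a classical Hopf manifold.
   Context: **Kodaira surface.** Use coordinates $(x,y,t,u)$ on $\mathrm{Heis}(3;\mathbb R)\times\mathbb R$, where $(x,y,t)$ corresponds to $\begin{pmatrix}1&x&t\\0&1&y\\0&0&1\end{pmatrix}$, and the holomorphic coordinates $z=\frac1{\sqrt2}(x+\sqrt{-1}y)$, $w=t-\frac12xy-\frac{\sqrt{-1}}4(x^2+y^2)+\sqrt{-1}u$. $\Gamma$ is a cocompact discrete subgroup acting by left translations (which are holomorphic in $(z,w)$), and the quotient $M$ is a primary Kodaira surface. One has $u=\frac12|z|^2-\frac{\sqrt{-1}}2(w-\bar w)$, so $\Phi=e^{u/2}$. The left-invariant Vaisman form is, up to a constant factor, $\omega=2\,dz\wedge d\bar z+\frac12(dw+\sqrt{-1}\bar z\,dz)\wedge(d\bar w-\sqrt{-1}z\,d\bar z)$; it is normalized here as $\omega=\Phi^{-1}\tilde\omega$, with $\tilde\omega=\frac{\sqrt{-1}}2\partial\bar\partial\Phi$.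 **Target.** $H^\infty_\lambda=(\ell^2(\mathbb C)\setminus\{0\})/\mathbb Z$, where $\mathbb Z$ is generated by $\lambda\cdot\mathrm{id}$, $\lambda\in\mathbb C\setminus\{0\}$, $|\lambda|\ne1$, with lcK form $\omega_H=\|z\|^{-2}\omega_0$, $\omega_0=\frac{\sqrt{-1}}2\partial\bar\partial\|z\|^2$. An lcK map is a holomorphic map $f\colon M\to H^\infty_\lambda$ with $f^*\omega_H=\omega$; it is induced by $F$ if $F$ takes values in $\ell^2(\mathbb C)\setminus\{0\}$ and $f\circ\pi_M=\pi_H\circ F$, with $\pi_M\colon\mathbb C^2\to M$ and $\pi_H\colon\ell^2(\mathbb C)\setminus\{0\}\to H^\infty_\lambda$ the quotient maps. *)

(* Defs.v *)
From HB Require Import structures.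
From mathcomp Require Import all_boot all_order all_algebra.
From mathcomp Require Import complex.
From mathcomp Require Import all_classical all_reals all_analysis.
From mathcomp Require Import ring lra.
Import Order.TTheory GRing.Theory Num.Theory.
Import numFieldNormedType.Exports.

Set Implicit Arguments.
Unset Strict Implicit.
Unset Printing Implicit Defensive.

Local Open Scope classical_set_scope.
Local Open Scope quotient_scope.
Local Open Scope ring_scope.
Local Open Scope complex_scope.

(* The topology and norm of MathComp-Analysis are only declared on R[i]^o. *)
HB.instance Definition _ (R : realType) := NormedModule.copy R[i] (R[i]^o).

Section SquareSummable.
Variable R : realType.
Local Notation C := (R[i]).
Implicit Types (u v : nat -> C) (a z w : C).

Definition sqmod z : R := complex.Re (`|z| ^+ 2).

Lemma sqmodE z : sqmod z = complex.Re z ^+ 2 + complex.Im z ^+ 2.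
Proof.
case: z => x y; rewrite /sqmod normc_def expr2 /= mulr0 subr0 -expr2.
by rewrite sqr_sqrtr// addr_ge0 ?sqr_ge0.
Qed.

Lemma sqmod_ge0 z : 0 <= sqmod z.
Proof. by rewrite sqmodE addr_ge0 ?sqr_ge0. Qed.

Lemma sqmodM z w : sqmod (z * w) = sqmod z * sqmod w.
Proof. by case: z w => [a b] [c d]; rewrite !sqmodE /=; ring. Qed.

Lemma normc_sqrt_sqmod z : `|z| = (Num.sqrt (sqmod z))%:C.
Proof. by case: z => a b; rewrite normc_def sqmodE. Qed.

Lemma sqr_normc_sqmod z : `|z| ^+ 2 = (sqmod z)%:C.
Proof.
by rewrite normc_sqrt_sqmod -(rmorphXn (real_complex R)) sqr_sqrtr// sqmod_ge0.
Qed.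

Lemma sqmod_eq0 z : sqmod z = 0 -> z = 0.
Proof.
by move=> h; apply/normr0_eq0; rewrite normc_sqrt_sqmod h sqrtr0.
Qed.

Lemma sqmodD (t : R) z w : 0 < t ->
  sqmod (z + w) <= (1 + t) * sqmod z + (1 + t^-1) * sqmod w.
Proof.
move=> t0; case: z w => [a b] [c d]; rewrite !sqmodE /=.
have key (x y : R) : 2 * x * y <= t * x ^+ 2 + t^-1 * y ^+ 2.
  rewrite -subr_ge0.
  have -> : t * x ^+ 2 + t^-1 * y ^+ 2 - 2 * x * y = t^-1 * (t * x - y) ^+ 2.
    by field; rewrite gt_eqF.
  by rewrite mulr_ge0 ?sqr_ge0// invr_ge0 ltW.
have := key a c; have := key b d; lra.
Qed.

Definition sqsum : {pred nat -> C} :=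
  fun u => `[< cvgn (series (fun n => sqmod (u n))) >].

Lemma sqsumP u : reflect (cvgn (series (fun n => sqmod (u n)))) (u \in sqsum).
Proof. exact: asboolP. Qed.

Lemma sqsumZ a u : u \in sqsum -> a \*: u \in sqsum.
Proof.
move=> /sqsumP hu; apply/sqsumP.
have -> : (fun n => sqmod ((a \*: u) n)) = sqmod a *: (fun n => sqmod (u n)).
  by apply/funext => n; rewrite /= /GRing.scale /= sqmodM.
exact: is_cvg_seriesZ.
Qed.

Lemma sqsumD u v : u \in sqsum -> v \in sqsum -> u \+ v \in sqsum.
Proof.
move=> /sqsumP hu /sqsumP hv; apply/sqsumP.
apply: (@series_le_cvg _ _
  ((2 : R) *: (fun n => sqmod (u n)) + (2 : R) *: (fun n => sqmod (v n)))).
- by move=> n; exact: sqmod_ge0.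
- by move=> n; rewrite addr_ge0 // mulr_ge0 ?sqmod_ge0.
- move=> n; apply: le_trans (sqmodD _ _ ltr01) _.
  by rewrite invr1.
- by apply: is_cvg_seriesD; apply: is_cvg_seriesZ.
Qed.

Lemma sqsum_submod_closed : submod_closed sqsum.
Proof.
split=> [|a u v hu hv]; last by apply: sqsumD => //; exact: sqsumZ.
apply/sqsumP.
have -> : (fun n => sqmod ((0 : nat -> C) n)) = (0 : R) *: (0 : nat -> R).
  by apply/funext => n; rewrite scale0r /sqmod normr0 expr0n.
by apply: is_cvg_seriesZ; rewrite /series /=; under eq_fun do rewrite big1//; exact: is_cvg_cst.
Qed.

HB.instance Definition _ :=
  GRing.isSubmodClosed.Build _ _ sqsum sqsum_submod_closed.

Record l2 : Type := L2 { l2_seq :> nat -> C ; _ : l2_seq \in sqsum }.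

HB.instance Definition _ := [isSub for l2_seq].
HB.instance Definition _ := [Choice of l2 by <:].
HB.instance Definition _ := [SubChoice_isSubLmodule of l2 by <:].

Implicit Types x y : l2.

Definition l2sq x : R := limn (series (fun n => sqmod (x n))).

Definition l2norm x : C := (Num.sqrt (l2sq x))%:C.

Lemma l2_cvg x : cvgn (series (fun n => sqmod (x n))).
Proof. by apply/sqsumP; case: x. Qed.

Lemma l2sq_ge0 x : 0 <= l2sq x.
Proof.
apply: limr_ge; first exact: l2_cvg.
by apply: nearW => n; rewrite /series /= sumr_ge0// => i _; exact: sqmod_ge0.
Qed.

Lemma l2sqZ a x : l2sq (a *: x) = sqmod a * l2sq x.
Proof.
rewrite /l2sq -[RHS]/(sqmod a *: _) -limZr; last exact: l2_cvg.
congr (limn _); apply/funext => n; rewrite /series /= -[RHS]/(_ * _) mulr_sumr.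
by apply: eq_bigr => i _; rewrite -sqmodM.
Qed.

Lemma l2sqD (t : R) x y : 0 < t ->
  l2sq (x + y) <= (1 + t) * l2sq x + (1 + t^-1) * l2sq y.
Proof.
move=> t0.
rewrite /l2sq -[X in _ <= X + _]/((1 + t) *: _).
rewrite -[X in _ <= _ + X]/((1 + t^-1) *: _).
rewrite -!limZr; [|exact: l2_cvg..].
rewrite -limD; [|by apply: is_cvgZr; exact: l2_cvg..].
apply: ler_lim; first exact: l2_cvg.
  by apply: is_cvgD; apply: is_cvgZr; exact: l2_cvg.
apply: nearW => n.
rewrite /series /= -[X in _ <= X]/(_ * _ + _ * _) !mulr_sumr -big_split /=.
by apply: ler_sum => i _; exact: sqmodD.
Qed.

Lemma l2sq_eq0 x : l2sq x = 0 -> x = 0.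
Proof.
move=> x0; apply/val_inj/funext => n; apply: sqmod_eq0.
apply/eqP; rewrite eq_le sqmod_ge0 andbT -x0.
apply: (@le_trans _ _ (series (fun k => sqmod (x k)) n.+1)).
  rewrite /series /= big_nat_recr //= lerDr sumr_ge0// => i _.
  exact: sqmod_ge0.
apply: nondecreasing_cvgn_le; last exact: l2_cvg.
by apply/nondecreasing_seqP => k; rewrite /series /= big_nat_recr //= lerDl sqmod_ge0.
Qed.

Lemma l2norm0_eq0 x : l2norm x = 0 -> x = 0.
Proof.
move=> /(congr1 (@complex.Re R)) /= h; apply: l2sq_eq0.
by apply/eqP; rewrite eq_le l2sq_ge0 andbT -sqrtr_eq0 h.
Qed.

Lemma l2normZ a x : l2norm (a *: x) = `|a| * l2norm x.
Proof.
rewrite /l2norm l2sqZ sqrtrM ?sqmod_ge0// normc_sqrt_sqmod.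
exact: (rmorphM (real_complex R)).
Qed.

Lemma l2normD x y : l2norm (x + y) <= l2norm x + l2norm y.
Proof.
have [->|/eqP x0] := eqVneq x 0.
  by rewrite add0r -[X in X <= _]add0r lerD2r /l2norm lecR sqrtr_ge0.
have [->|/eqP y0] := eqVneq y 0.
  by rewrite addr0 -[X in X <= _]addr0 lerD2l /l2norm lecR sqrtr_ge0.
have pos (s : l2) : s <> 0 -> 0 < Num.sqrt (l2sq s).
  move=> z0; rewrite lt_def sqrtr_ge0 andbT; apply/eqP => h; apply: z0.
  by apply: l2norm0_eq0; rewrite /l2norm h.
have := pos x x0; have := pos y y0.
rewrite /l2norm -(rmorphD (real_complex R)) lecR.
move: (sqr_sqrtr (l2sq_ge0 x)) (sqr_sqrtr (l2sq_ge0 y)).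
set a := Num.sqrt (l2sq x); set b := Num.sqrt (l2sq y) => ax bx b0 a0.
rewrite -(ger0_norm (ltW (addr_gt0 a0 b0))) -sqrtr_sqr ler_sqrt ?sqr_ge0//.
have := @l2sqD (b / a) x y (divr_gt0 b0 a0); rewrite -ax -bx.
move=> /le_trans; apply.
suff -> : (1 + b / a) * a ^+ 2 + (1 + (b / a)^-1) * b ^+ 2 = (a + b) ^+ 2 by [].
by field; rewrite !gt_eqF.
Qed.

HB.instance Definition _ := Lmodule_isNormed.Build C l2 l2normD l2normZ l2norm0_eq0.

Lemma l2_normE x : `|x| = l2norm x. Proof. by []. Qed.

End SquareSummable.

(* Differential forms of degree two: a base point, then two real tangent
   vectors. A real tangent vector of a complex vector space V is an element
   of V, multiplication by 'i being the complex structure. *)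
Definition form2 (R : realType) (V : Type) := V -> V -> V -> R[i].

Section Forms.
Variable R : realType.
Local Notation C := (R[i]).

Section Dolbeault.
Variable V : lmodType C.
Implicit Types (f phi : V -> C) (p v w : V).

(* The increment is real, so that f need not be holomorphic. *)
Definition dirD v f p : C :=
  derive1 (fun t : R => complex.Re (f (p + t%:C *: v))) 0
  +i* derive1 (fun t : R => complex.Im (f (p + t%:C *: v))) 0.

Definition del v f p : C := (dirD v f p - 'i * dirD ('i *: v) f p) / 2.

Definition delbar v f p : C := (dirD v f p + 'i * dirD ('i *: v) f p) / 2.

(* The wedge convention is (a /\ b)(v, w) = a(v) b(w) - a(w) b(v). *)
Definition deldelbar phi : form2 R V := fun p v w =>
  del v (delbar w phi) p - del w (delbar v phi) p.

Definition kahler_form phi : form2 R V := fun p v w =>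
  'i / 2 * deldelbar phi p v w.

End Dolbeault.

Definition pullback (V W : normedModType C) (F : V -> W) (omega : form2 R W) :
    form2 R V :=
  fun p v w => omega (F p) ('d F p v) ('d F p w).

End Forms.

Section KodairaSurface.
Variable R : realType.
Local Notation C := (R[i]).

(* (x, y, t, u), where (x, y, t) stands for the matrix heis_mx below *)
Definition heisR : Type := (R * R * R * R)%type.

HB.instance Definition _ := Topological.copy heisR (R * R * R * R)%type.

Implicit Types g h : heisR.

Definition heis_one : heisR := (0, 0, 0, 0).

Definition heis_mul g h : heisR :=
  let: (x, y, t, u) := g in let: (x', y', t', u') := h in
  (x + x', y + y', t + t' + x * y', u + u').

Definition heis_inv g : heisR :=
  let: (x, y, t, u) := g in (- x, - y, x * y - t, - u).

Definition heis_mx g : 'M[R]_3 :=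
  let: (x, y, t, u) := g in
  \matrix_(i < 3, j < 3)
    nth 0 (nth [::] [:: [:: 1; x; t]; [:: 0; 1; y]; [:: 0; 0; 1]] i) j.

Lemma heis_mx_mul g h : heis_mx (heis_mul g h) = heis_mx g *m heis_mx h.
Proof.
case: g => [[[x y] t] u]; case: h => [[[x' y'] t'] u'].
apply/matrixP => i j; rewrite !mxE !big_ord_recl big_ord0 !mxE /=.
by case: i => [[|[|[|//]]] ?]; case: j => [[|[|[|//]]] ?] /=; ring.
Qed.

Lemma heis_mulA : associative heis_mul.
Proof.
move=> [[[x y] t] u] [[[x' y'] t'] u'] [[[a b] c] d] /=.
by congr (_, _, _, _); ring.
Qed.

Lemma heis_mul1 : left_id heis_one heis_mul.
Proof. by move=> [[[x y] t] u] /=; congr (_, _, _, _); ring. Qed.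

Lemma heis_mulr1 : right_id heis_one heis_mul.
Proof. by move=> [[[x y] t] u] /=; congr (_, _, _, _); ring. Qed.

Lemma heis_mulV : left_inverse heis_one heis_inv heis_mul.
Proof. by move=> [[[x y] t] u] /=; congr (_, _, _, _); ring. Qed.

Lemma heis_mulrV : right_inverse heis_one heis_inv heis_mul.
Proof. by move=> [[[x y] t] u] /=; congr (_, _, _, _); ring. Qed.

HB.instance Definition _ := isGroup.Build heisR
  heis_mulA heis_mul1 heis_mulr1 heis_mulV heis_mulrV.

Definition holo_coord g : C * C :=
  let: (x, y, t, u) := g in
  ((x / Num.sqrt 2) +i* (y / Num.sqrt 2),
   (t - x * y / 2) +i* (u - (x ^+ 2 + y ^+ 2) / 4)).

Definition real_coord (p : C * C) : heisR :=
  let: (a +i* b, c +i* d) := p in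
  (Num.sqrt 2 * a, Num.sqrt 2 * b, c + a * b, d + (a ^+ 2 + b ^+ 2) / 2).

Let sqrt2_neq0 : Num.sqrt 2 != 0 :> R.
Proof. by rewrite gt_eqF// sqrtr_gt0. Qed.

Let sqr_sqrt2 : Num.sqrt 2 ^+ 2 = 2 :> R.
Proof. by rewrite sqr_sqrtr. Qed.

Lemma holo_coordK : cancel holo_coord real_coord.
Proof.
move=> [[[x y] t] u] /=; have := sqr_sqrt2; have := sqrt2_neq0.
set s := Num.sqrt 2 => s0 s2.
have e : x / s * (y / s) = x * y / 2 by rewrite -s2; field.
have e' : (x / s) ^+ 2 + (y / s) ^+ 2 = (x ^+ 2 + y ^+ 2) / 2.
  by rewrite -s2; field.
by rewrite e e'; congr (_, _, _, _); field.
Qed.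

Lemma real_coordK : cancel real_coord holo_coord.
Proof.
move=> [[a b] [c d]] /=; have := sqr_sqrt2; have := sqrt2_neq0.
set s := Num.sqrt 2 => s0 s2; congr (_ +i* _, _ +i* _); try by field.
- by rewrite mulrACA -expr2 s2; field.
- by rewrite !exprMn s2; field.
Qed.

Lemma Phi_exponentE (p : C * C) :
  `|p.1| ^+ 2 / 4 - 'i / 4 * (p.2 - p.2^*)
  = (sqmod p.1 / 4 + complex.Im p.2 / 2)%:C.
Proof.
have e4 : 4^-1 = (4^-1)%:C :> C.
  by rewrite (fmorphV (real_complex R)) (rmorph_nat (real_complex R)).
rewrite sqr_normc_sqmod e4; case: p => [z [c d]] /=.
apply/eqP; rewrite eq_complex /=; by apply/andP; split; apply/eqP; field.
Qed.

(* The exponent is real by Phi_exponentE, so taking its real part is harmless. *)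
Definition Phi (p : C * C) : C :=
  (expR (complex.Re (`|p.1| ^+ 2 / 4 - 'i / 4 * (p.2 - p.2^*))))%:C.

Lemma Phi_holo_coord g :
  Phi (holo_coord g) = (expR (let: (_, _, _, u) := g in u / 2))%:C.
Proof.
rewrite /Phi Phi_exponentE; case: g => [[[x y] t] u]; rewrite sqmodE /=.
congr (expR _)%:C; have := sqr_sqrt2; have := sqrt2_neq0.
set s := Num.sqrt 2 => s0 s2.
have -> : (x / s) ^+ 2 + (y / s) ^+ 2 = (x ^+ 2 + y ^+ 2) / 2.
  by rewrite -s2; field.
by field.
Qed.

Definition omega_tilde : form2 R (C * C)%type := kahler_form Phi.

(* Invariant under the left translations, hence the lift to C^2 of a form on
   the quotient. *)
Definition omega_kodaira : form2 R (C * C)%type :=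
  fun p v w => (Phi p)^-1 * omega_tilde p v w.

Section Quotient.
Variable Gamma : groupClosed heisR.

Definition left_orbit_rel : rel heisR :=
  fun g h => `[< exists2 a, a \in Gamma & h = (a * g)%g >].

Lemma left_orbit_refl : reflexive left_orbit_rel.
Proof.
by move=> g; apply/asboolP; exists 1%g; [exact: gpred1|rewrite mul1g].
Qed.

Lemma left_orbit_sym : symmetric left_orbit_rel.
Proof.
have sub g h : left_orbit_rel g h -> left_orbit_rel h g.
  move=> /asboolP[a aG ->]; apply/asboolP; exists (a^-1)%g.
    by rewrite gpredV.
  by rewrite mulKg.
by move=> g h; apply/idP/idP; exact: sub.
Qed.

Lemma left_orbit_trans : transitive left_orbit_rel.
Proof.
move=> h g k /asboolP[a aG ->] /asboolP[b bG ->]; apply/asboolP.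
by exists (b * a)%g; [exact: gpredM|rewrite mulgA].
Qed.

Canonical left_orbit_equiv :=
  EquivRel left_orbit_rel left_orbit_refl left_orbit_sym left_orbit_trans.

Definition kodaira : Type := quotient_topology {eq_quot left_orbit_rel}.

HB.instance Definition _ := Topological.on kodaira.
HB.instance Definition _ := Quotient.on kodaira.

Definition pi_M (p : C * C) : kodaira := \pi_kodaira (real_coord p).

Definition lattice : Prop :=
  [set` Gamma] `<=` isolated [set` Gamma] /\ compact [set: kodaira].

End Quotient.
End KodairaSurface.

Section HopfManifold.
Variable R : realType.
Local Notation C := (R[i]).

Definition l2star : Type := ~` [set 0 : l2 R].

HB.instance Definition _ := Topological.on l2star.

Definition l2star_val (x : l2star) : l2 R := set_val x.

Definition omega_0 : form2 R (l2 R) := kahler_form (fun x => `|x| ^+ 2).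

(* Only meaningful off the origin, where it is invariant under scalings. *)
Definition omega_hopf : form2 R (l2 R) :=
  fun q v w => (`|q| ^+ 2)^-1 * omega_0 q v w.

Section Quotient.
Variable lambda : C.

(* If lambda = 0 this is the equality relation, 0 being excluded. *)
Definition hopf_rel : rel l2star := fun x y =>
  `[< exists k : int, l2star_val y = lambda ^ k *: l2star_val x >].

Lemma hopf_refl : reflexive hopf_rel.
Proof. by move=> x; apply/asboolP; exists 0; rewrite expr0z scale1r. Qed.

Lemma l2star_neq0 (x : l2star) : l2star_val x != 0.
Proof. by apply/eqP; exact: (set_valP x). Qed.

Lemma hopf_relP x y : reflect
  (exists2 k : int, lambda ^ k != 0 & l2star_val y = lambda ^ k *: l2star_val x)
  (hopf_rel x y).
Proof.
apply: (iffP (asboolP _)) => [[k e]|[k _ e]]; exists k => //.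
by apply/eqP => l0; have := l2star_neq0 y; rewrite e l0 scale0r eqxx.
Qed.

Lemma hopf_sym : symmetric hopf_rel.
Proof.
have sub x y : hopf_rel x y -> hopf_rel y x.
  move=> /hopf_relP[k l0 e]; apply/asboolP; exists (- k).
  by rewrite e scalerA -invr_expz mulVf// scale1r.
by move=> x y; apply/idP/idP; exact: sub.
Qed.

Lemma hopf_trans : transitive hopf_rel.
Proof.
move=> y x z /hopf_relP[k l0 e] /hopf_relP[m l1 e']; apply/asboolP.
have [l_eq0|l_neq0] := eqVneq lambda 0.
  exists 0; move: l0 l1 e e'; rewrite l_eq0 !exp0rz.
  case: (k == 0) => /=; rewrite ?eqxx// => _.
  case: (m == 0) => /=; rewrite ?eqxx// => _ -> ->.
  by rewrite !scale1r.
by exists (m + k); rewrite e' e scalerA expfzDr.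
Qed.

Canonical hopf_equiv := EquivRel hopf_rel hopf_refl hopf_sym hopf_trans.

Definition hopf : Type := quotient_topology {eq_quot hopf_rel}.

HB.instance Definition _ := Topological.on hopf.
HB.instance Definition _ := Quotient.on hopf.

Definition pi_H (x : l2star) : hopf := \pi_hopf x.

End Quotient.
End HopfManifold.

Section Maps.
Variable R : realType.
Local Notation C := (R[i]).

Definition kahler_map (F : C * C -> l2 R) : Prop :=
  (forall p, differentiable F p) /\
  (forall p v w, pullback F (omega_0 (R := R)) p v w = omega_tilde p v w).

Variables (Gamma : groupClosed (heisR R)) (lambda : C).
Implicit Type f : kodaira Gamma -> hopf lambda.

(* The charts of the quotients are the local inverses of pi_M and pi_H: G is
   the expression of f in the charts given by U and V. *)
Definition chart_expr f (U : set (C * C)) (V : set (l2star R))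
    (G : C * C -> l2star R) : Prop :=
  [/\ open U, {in U &, injective (pi_M Gamma)},
      open V, {in V &, injective (@pi_H R lambda)} &
      forall p, U p -> V (G p) /\ pi_H lambda (G p) = f (pi_M Gamma p)].

Definition holomorphic_map f : Prop :=
  continuous f /\
  forall U V G, chart_expr f U V G ->
    forall p, U p -> differentiable (@l2star_val R \o G) p.

(* The forms of M and of the Hopf manifold are given in these charts by
   omega_kodaira and omega_hopf. *)
Definition lck_map f : Prop :=
  holomorphic_map f /\
  forall U V G, chart_expr f U V G ->
    forall p v w, U p ->
      pullback (@l2star_val R \o G) (omega_hopf (R := R)) p v w
      = omega_kodaira p v w.

Definition induces (F : C * C -> l2 R) f : Prop :=
  exists F' : C * C -> l2star R,
    F = @l2star_val R \o F' /\ f \o pi_M Gamma = @pi_H R lambda \o F'.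

End Maps.

(* Main.v *)
Require Import Defs.
From mathcomp Require Import all_boot all_order all_algebra.
From mathcomp Require Import complex.
From mathcomp Require Import all_classical all_reals all_analysis.
From mathcomp Require Import ring lra.
Import Order.TTheory GRing.Theory Num.Theory.
Import numFieldNormedType.Exports.

Set Implicit Arguments.
Unset Strict Implicit.
Unset Printing Implicit Defensive.

Local Open Scope classical_set_scope.
Local Open Scope quotient_scope.
Local Open Scope complex_scope.
Local Open Scope ring_scope.

(* Since omega_tilde vanishes nowhere, comparing F^*omega_0 = omega_tilde with
   F^*omega_H = omega forces |F|^2 = Phi. Both sides of <F p, F q> = kernel p q
   are holomorphic in p and antiholomorphic in q, so this identity propagates
   from the diagonal: on the complex line through p and q it amounts to an entire
   function of one variable vanishing on the real line. As F is only assumed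
   complex differentiable, this uniqueness is derived from Goursat's lemma.
   If F p' and F p are proportional, equality in the Cauchy-Schwarz inequality
   for kernel gives p'.1 = p.1. An induced map f makes F proportional along the
   orbits of Gamma, hence Gamma fixes the coordinate z; then x descends to an
   unbounded continuous function on the compact surface M. *)

(** * Goursat's lemma *)

Section Primitives.
Variable R : realType.
Implicit Types (g G : R -> R) (a b m e : R).

(** The integral from [a] is a primitive by the fundamental theorem of calculus, at interior points
    only. Hence every contour below stays strictly inside a larger rectangle. *)
Lemma exists_primitive g a b : continuous g ->
  exists G, forall x, a < x < b -> is_derive x 1 G (g x).
Proof.
move=> cg.
exists (fun x => (\int[lebesgue_measure]_(t in [set` `[a, x]]) (g t))%R).
move=> x /andP[ax xb].
have ig : lebesgue_measure.-integrable `[a, b] (EFin \o g).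
  apply: continuous_compact_integrable; first exact: segment_compact.
  exact: continuous_subspaceT.
have [dG] := @continuous_FTC1_closed R g a x b xb ig ax (cg x).
by rewrite derive1E; exact: DeriveDef.
Qed.

(** Plays the role of the bound on the integral of [g - m] over [[a, b]]; the mean value theorem
    replaces integration. *)
Lemma increment_near g G a b m e : a <= b ->
  (forall x, a <= x <= b -> is_derive x 1 G (g x)) ->
  (forall x, a <= x <= b -> `|g x - m| <= e) ->
  `|G b - G a - m * (b - a)| <= e * (b - a).
Proof.
move=> ab dG gm.
have [x||x xab ->] := @MVT_segment R G g a b ab.
- by rewrite in_itv/= => /andP[ax xb]; apply: dG; rewrite !ltW.
- apply: derivable_within_continuous => x; rewrite in_itv /= => xab.
  by have [] := dG x xab.
rewrite -mulrBl normrM (ger0_norm (x := b - a)) ?subr_ge0//.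
by rewrite ler_wpM2r ?subr_ge0//; apply: gm; move: xab; rewrite in_itv.
Qed.

(** Nested intervals, recorded by their left endpoints: the limit of the increasing sequence [u]
    lies in all of them. *)
Lemma dyadic_nested (u : nat -> R) (w : R) : 0 <= w ->
  (forall n, u n <= u n.+1 <= u n + w / 2 ^+ n.+1) ->
  exists l, forall n, u n <= l <= u n + w / 2 ^+ n.
Proof.
move=> w0 hu.
have nu : nondecreasing_seq u.
  by apply/nondecreasing_seqP => n; have /andP[] := hu n.
(* The subtracted term is the length of the interval of index [n + k]; keeping it makes the
   induction on [k] close. *)
have ub n k : u (n + k)%N <= u n + w / 2 ^+ n - w / 2 ^+ (n + k).
  elim: k => [|k IH]; first by rewrite addn0 addrK.
  have /andP[_] := hu (n + k)%N; rewrite addnS => /le_trans; apply.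
  move: IH; have -> : w / 2 ^+ (n + k) = w / 2 ^+ (n + k).+1 + w / 2 ^+ (n + k).+1.
    by rewrite exprS; field; rewrite expf_neq0.
  by move: (u _) (u _) (w / _) (w / _) => ? ? ? ?; lra.
have ub' n k : u k <= u n + w / 2 ^+ n.
  have e0 (m : nat) : 0 <= w / 2 ^+ m by rewrite divr_ge0// exprn_ge0.
  case: (leqP n k) => [/subnKC <-|kn].
    by apply: le_trans (ub n _) _; rewrite lerBlDr lerDl.
  by apply: le_trans (nu _ _ (ltnW kn)) _; rewrite lerDl.
have cu : cvgn u.
  by apply: nondecreasing_is_cvgn => //; exists (u 0%N + w / 2 ^+ 0) => _ [k _ <-].
exists (limn u) => n; rewrite nondecreasing_cvgn_le//=.
by apply: limr_le => //; apply: nearW => k.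
Qed.

End Primitives.

Section Goursat.
Variable R : realType.
Implicit Types (U V : R -> R -> R) (x y : R).

(* U + i V is complex differentiable, with derivative al + i be at (x, y). *)
Definition cr_differentiable U V := forall x y, exists al be : R,
  forall e, 0 < e -> exists2 d, 0 < d & forall x' y',
    `|x' - x| <= d -> `|y' - y| <= d ->
    `|U x' y' - (U x y + al * (x' - x) - be * (y' - y))|
      <= e * (`|x' - x| + `|y' - y|) /\
    `|V x' y' - (V x y + be * (x' - x) + al * (y' - y))|
      <= e * (`|x' - x| + `|y' - y|).

Variables (U V P Q : R -> R -> R).

(* With P y a primitive of U^~ y and Q x one of V x, this is the real part of
   the integral of U + i V along the boundary of [a, b] x [c, d]. *)
Definition circulation (a b c d : R) : R :=
  (P c b - P c a) - (Q b d - Q b c) - (P d b - P d a) + (Q a d - Q a c).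

(** Each interior side is traversed twice, in opposite directions, and cancels. *)
Lemma circulation_split (a b c d m n : R) :
  circulation a b c d = circulation a m c n + circulation m b c n
    + circulation a m n d + circulation m b n d.
Proof. by rewrite /circulation; ring. Qed.

Variables (A B C D : R).
Hypothesis UV_cr : cr_differentiable U V.
Hypothesis dP : forall x y, A < x < B -> is_derive x 1 (P y) (U x y).
Hypothesis dQ : forall x y, C < y < D -> is_derive y 1 (Q x) (V x y).

(** Near [(x0, y0)] the pair is affine up to a small error. Opposite sides are subtracted: the
    affine part contributes [be * (b - a) * (d - c)] once through [P] and once through [Q], and by
    the Cauchy-Riemann equations the two cancel. *)
Lemma circulation_small x0 y0 e : 0 < e -> exists2 r, 0 < r &
  forall a b c d, a <= x0 <= b -> c <= y0 <= d -> b - a <= r -> d - c <= r ->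
    A < a -> b < B -> C < c -> d < D ->
    `|circulation a b c d| <= e * ((b - a) + (d - c)) ^+ 2.
Proof.
move=> e0; have [al [be h]] := UV_cr x0 y0.
(* Half of [e], since each difference of opposite sides adds two errors. *)
have [r r0 {}h] := h (e / 2) (divr_gt0 e0 (ltr0Sn _ 1)).
exists r => // a b c d /andP[ax xb] /andP[cy yd] bar dcr Aa bB Cc dD.
set s := (b - a) + (d - c).
have near x y : a <= x <= b -> c <= y <= d ->
  `|U x y - (U x0 y0 + al * (x - x0) - be * (y - y0))| <= e / 2 * s /\
  `|V x y - (V x0 y0 + be * (x - x0) + al * (y - y0))| <= e / 2 * s.
  move=> /andP[ax' xb'] /andP[cy' yd'].
  have hx : `|x - x0| <= b - a by rewrite ler_norml; apply/andP; split; lra.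
  have hy : `|y - y0| <= d - c by rewrite ler_norml; apply/andP; split; lra.
  have [] := h x y (le_trans hx bar) (le_trans hy dcr).
  have hs : e / 2 * (`|x - x0| + `|y - y0|) <= e / 2 * s.
    by rewrite ler_wpM2l ?lerD// divr_ge0// ltW.
  by move=> h1 h2; split; [exact: le_trans h1 hs|exact: le_trans h2 hs].
have cc : c <= c <= d by rewrite lexx/=; lra.
have dd : c <= d <= d by rewrite lexx andbT; lra.
have aa : a <= a <= b by rewrite lexx/=; lra.
have bb : a <= b <= b by rewrite lexx andbT; lra.
have h1 : `|(P c b - P d b) - (P c a - P d a) - be * (d - c) * (b - a)|
    <= e * s * (b - a).
  apply: (@increment_near R (fun x => U x c - U x d) (fun x => P c x - P d x)).
  - lra.
  - move=> x /andP[ax' xb']; apply: is_deriveB; apply: dP; apply/andP; split; lra.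
  - move=> x xab; have [n1 _] := near x c xab cc; have [n2 _] := near x d xab dd.
    move: n1 n2; rewrite !ler_norml => /andP[? ?] /andP[? ?].
    by apply/andP; split; lra.
have h2 : `|(Q b d - Q a d) - (Q b c - Q a c) - be * (b - a) * (d - c)|
    <= e * s * (d - c).
  apply: (@increment_near R (fun y => V b y - V a y) (fun y => Q b y - Q a y)).
  - lra.
  - move=> y /andP[cy' yd']; apply: is_deriveB; apply: dQ; apply/andP; split; lra.
  - move=> y ycd; have [_ n1] := near b y bb ycd; have [_ n2] := near a y aa ycd.
    move: n1 n2; rewrite !ler_norml => /andP[? ?] /andP[? ?].
    by apply/andP; split; lra.
have -> : e * s ^+ 2 = e * s * (b - a) + e * s * (d - c) by rewrite /s; ring.
have -> : circulation a b c d =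
  ((P c b - P d b) - (P c a - P d a) - be * (d - c) * (b - a))
  - ((Q b d - Q a d) - (Q b c - Q a c) - be * (b - a) * (d - c)).
  by rewrite /circulation; ring.
by apply: le_trans (ler_normB _ _) _; exact: lerD.
Qed.

(** Bisection: a rectangle with circulation of modulus at least [K] has a quarter with at least
    [K / 4]. Iterating, the rectangles shrink to a point, where [circulation_small] gives a bound of
    order [4 ^- n] with too small a constant. *)
Theorem goursat a b c d : A < a -> a <= b -> b < B -> C < c -> c <= d -> d < D ->
  circulation a b c d = 0.
Proof.
move=> Aa ab bB Cc cd dD; apply/eqP; apply: contraT => I0.
set K := `|circulation a b c d|.
have K0 : 0 < K by rewrite normr_gt0.
pose w := b - a; pose h := d - c.
have w0 : 0 <= w by rewrite subr_ge0.
have h0 : 0 <= h by rewrite subr_ge0.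
pose I n (q : R * R) :=
  circulation q.1 (q.1 + w / 2 ^+ n) q.2 (q.2 + h / 2 ^+ n).
pose bad n q := K / 4 ^+ n <= `|I n q|.
have half (t : R) n : t / 2 ^+ n = t / 2 ^+ n.+1 + t / 2 ^+ n.+1.
  by rewrite exprS; field; rewrite expf_neq0.
(* The existential stands outside the implication so that [choice] yields a total function; a [q]
   that is not bad is returned unchanged. *)
have step n q : exists q', bad n q -> [/\ bad n.+1 q',
    q.1 <= q'.1 <= q.1 + w / 2 ^+ n.+1 & q.2 <= q'.2 <= q.2 + h / 2 ^+ n.+1].
  have wn : 0 <= w / 2 ^+ n.+1 by rewrite divr_ge0 // exprn_ge0.
  have hn : 0 <= h / 2 ^+ n.+1 by rewrite divr_ge0 // exprn_ge0.
  have [bq|] := pselect (bad n q); last by exists q.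
  pose q00 := (q.1, q.2); pose q10 := (q.1 + w / 2 ^+ n.+1, q.2).
  pose q01 := (q.1, q.2 + h / 2 ^+ n.+1).
  pose q11 := (q.1 + w / 2 ^+ n.+1, q.2 + h / 2 ^+ n.+1).
  have [b00|g00] := leP (K / 4 ^+ n.+1) `|I n.+1 q00|.
    by exists q00 => _; rewrite /= !lexx !lerDl wn hn.
  have [b10|g10] := leP (K / 4 ^+ n.+1) `|I n.+1 q10|.
    by exists q10 => _; rewrite /= !lexx !lerDl wn hn.
  have [b01|g01] := leP (K / 4 ^+ n.+1) `|I n.+1 q01|.
    by exists q01 => _; rewrite /= !lexx !lerDl wn hn.
  have [b11|g11] := leP (K / 4 ^+ n.+1) `|I n.+1 q11|.
    by exists q11 => _; rewrite /= !lexx !lerDl wn hn.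
  exfalso; move: bq; rewrite /bad; apply/negP; rewrite -ltNge.
  have -> : I n q = I n.+1 q00 + I n.+1 q10 + I n.+1 q01 + I n.+1 q11.
    rewrite /I /= (circulation_split _ _ _ _
      (q.1 + w / 2 ^+ n.+1) (q.2 + h / 2 ^+ n.+1)).
    by rewrite -!addrA -!half !addrA.
  have -> : K / 4 ^+ n =
      K / 4 ^+ n.+1 + K / 4 ^+ n.+1 + K / 4 ^+ n.+1 + K / 4 ^+ n.+1.
    by rewrite exprS; field; rewrite expf_neq0.
  do 3 (apply: le_lt_trans (ler_normD _ _) _; rewrite ltrD//).
pose f n := projT1 (choice (step n)).
have hf n := projT2 (choice (step n)) : forall x : R * R, bad n x -> _.
pose q := fix q n := if n is m.+1 then f m (q m) else (a, c).
have badq n : bad n (q n).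
  elim: n => [|n IH]; last by have [] := hf n _ IH.
  by rewrite /bad /I /= !expr0 !divr1 /w /h !subrKC.
have [x0 hx] := @dyadic_nested R (fun n => (q n).1) w w0
  (fun n => let: And3 _ e _ := hf n _ (badq n) in e).
have [y0 hy] := @dyadic_nested R (fun n => (q n).2) h h0
  (fun n => let: And3 _ _ e := hf n _ (badq n) in e).
have s0 : 0 <= w + h by rewrite addr_ge0.
(* Makes the final bound at most [K / 2 / 4 ^+ n]; the summand 1 keeps the denominator positive for
   a degenerate rectangle. *)
pose e := K / (2 * (1 + w + h) ^+ 2).
have s1 : 0 < (1 + w + h) ^+ 2 by rewrite exprn_gt0 // -addrA ltr_wpDr.
have e0 : 0 < e by rewrite divr_gt0 // mulr_gt0.
have [r r0 small] := circulation_small x0 y0 e0.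
have [n hn] : exists n, (w + h) / 2 ^+ n <= r.
  (* This exponent exceeds [(w + h) / r], and [n < 2 ^ n]. *)
  exists (Num.truncn ((w + h) / r)).+1.
  rewrite ler_pdivrMr ?exprn_gt0// -ler_pdivrMl// mulrC.
  apply: le_trans (ltW (truncnS_gt _)) _.
  by rewrite -natrX ler_nat ltnW// ltn_expl.
(* The nested rectangles stay inside the original one, hence where [P] and [Q] are primitives. *)
have lo1 m : a <= (q m).1.
  elim: m => [|m IH] //; apply: le_trans IH _.
  by have [_ /andP[]] := hf m _ (badq m).
have lo2 m : c <= (q m).2.
  elim: m => [|m IH] //; apply: le_trans IH _.
  by have [_ _ /andP[]] := hf m _ (badq m).
have hi1 m : (q m).1 + w / 2 ^+ m <= b.
  elim: m => [|m IH]; first by rewrite expr0 divr1 subrKC.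
  apply: le_trans IH; rewrite [w / 2 ^+ m]half.
  by have [_ /andP[_]] := hf m _ (badq m); rewrite addrA lerD2r.
have hi2 m : (q m).2 + h / 2 ^+ m <= d.
  elim: m => [|m IH]; first by rewrite expr0 divr1 subrKC.
  apply: le_trans IH; rewrite [h / 2 ^+ m]half.
  by have [_ _ /andP[_]] := hf m _ (badq m); rewrite addrA lerD2r.
have w2 : 0 <= w / 2 ^+ n by rewrite divr_ge0// exprn_ge0.
have h2 : 0 <= h / 2 ^+ n by rewrite divr_ge0// exprn_ge0.
move: hn; rewrite mulrDl => hn.
have := small _ _ _ _ (hx n) (hy n).
rewrite ![_ + _ - _]addrAC !subrr !add0r.
move=> /(_ _ _ _ _ _ _) {}small.
have : K / 4 ^+ n <= e * (w / 2 ^+ n + h / 2 ^+ n) ^+ 2.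
  apply: le_trans (badq n) _; apply: small.
  - lra.
  - lra.
  - exact: lt_le_trans (lo1 n).
  - exact: le_lt_trans (hi1 n) _.
  - exact: lt_le_trans (lo2 n).
  - exact: le_lt_trans (hi2 n) _.
have -> : e * (w / 2 ^+ n + h / 2 ^+ n) ^+ 2 = e * (w + h) ^+ 2 / 4 ^+ n.
  have -> : 4 ^+ n = (2 ^+ n) ^+ 2 :> R by rewrite -exprM mulnC exprM expr2 -natrM.
  have : (2 : R) ^+ n != 0 by rewrite expf_neq0.
  by move: (2 ^+ n) => t t0; field.
rewrite ler_pM2r ?invr_gt0 ?exprn_gt0// => Ke.
have : e * (w + h) ^+ 2 <= e * (1 + w + h) ^+ 2.
  rewrite ler_wpM2l ?(ltW e0)// ler_pXn2r ?nnegrE//; lra.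
have -> : e * (1 + w + h) ^+ 2 = K / 2.
  by rewrite /e; field; rewrite gt_eqF// -addrA ltr_wpDr.
lra.
Qed.

End Goursat.

(** * Gaussian mass estimates and continuity of Cauchy-Riemann pairs *)

Section RealEstimates.
Variable R : realType.
Implicit Types (g G : R -> R) (a b m e : R).

Lemma increment_ge g G a b m : a <= b ->
  (forall x, a <= x <= b -> is_derive x 1 G (g x)) ->
  (forall x, a <= x <= b -> m <= g x) -> m * (b - a) <= G b - G a.
Proof.
move=> ab dG gm.
have [x||x xab ->] := @MVT_segment R G g a b ab.
- by rewrite in_itv/= => /andP[ax xb]; apply: dG; rewrite !ltW.
- apply: derivable_within_continuous => x; rewrite in_itv /= => xab.
  by have [] := dG x xab.
by rewrite ler_wpM2r ?subr_ge0//; apply: gm; move: xab; rewrite in_itv.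
Qed.

Lemma bounded_on_segment g a b : a <= b -> continuous g ->
  exists2 M : R, 0 < M & forall x, a <= x <= b -> `|g x| <= M.
Proof.
move=> ab cg.
have [|c _ hc] := @EVT_max R (fun x => `|g x|) a b ab.
  apply: continuous_subspaceT => x.
  by apply: continuous_comp (cg x) _; exact: norm_continuous.
exists (`|g c| + 1) => [|x xab]; first by rewrite ltr_wpDl.
by rewrite -[leLHS]addr0 lerD// hc// in_itv.
Qed.

Lemma gaussian_mass g : continuous g -> g 0 = 1 ->
  exists d M : R, [/\ 0 < d <= 1, 0 < M & forall (N : R) G, 0 <= N ->
    (forall x : R, -2 <= x <= 2 -> is_derive x 1 G (g x * expR (- N * x ^+ 2))) ->
    d / 2 * expR (- N * (d / 2) ^+ 2) - M * expR (- N * d ^+ 2)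
      <= G 2 - G (-2)].
Proof.
move=> cg g0.
have [M0 M00 gM] : exists2 M : R, 0 < M & forall x : R, -2 <= x <= 2 -> `|g x| <= M.
  by apply: bounded_on_segment => //; lra.
have [d0 /andP[d00 d01] gd] : exists2 d : R, 0 < d <= 1 &
    forall x : R, `|x| <= d -> 1 / 2 <= g x.
  have /cvgrPdist_le/(_ (1/2)) := cg 0.
  rewrite g0 => /(_ ltac:(lra)) /nbhs_ballP [r /= r0 hr].
  exists (Num.min 1 (r / 2)).
    by rewrite lt_min ge_min lexx ltr01 divr_gt0.
  move=> x; rewrite le_min => /andP[x1 xr].
  have /hr : ball (0:R) r x by rewrite /ball /= sub0r normrN; lra.
  by rewrite /= ler_norml => /andP[]; lra.
exists d0, (4 * M0); split; [by rewrite d00| lra |].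
move=> N G N0 dG.
have hexp (s t : R) : 0 <= s -> s <= `|t| -> expR (- N * t ^+ 2) <= expR (- N * s ^+ 2).
  move=> s0 st; rewrite ler_expR !mulNr lerN2 ler_wpM2l// -[leRHS]real_normK ?num_real//.
  by rewrite ler_pXn2r ?nnegrE//.
have outer x : d0 <= `|x| -> -2 <= x <= 2 ->
    - (M0 * expR (- N * d0 ^+ 2)) <= g x * expR (- N * x ^+ 2).
  move=> dx x2; apply: (@le_trans _ _ (- (M0 * expR (- N * x ^+ 2)))).
    by rewrite lerN2 ler_wpM2l// ?(ltW M00)// hexp// ltW.
  rewrite -mulNr ler_wpM2r ?expR_ge0//.
  by have := gM x x2; rewrite ler_norml => /andP[].
have middle x : `|x| <= d0 -> 0 <= g x * expR (- N * x ^+ 2).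
  by move=> xd; rewrite mulr_ge0 ?expR_ge0//; have := gd x xd; lra.
have inner x : `|x| <= d0 / 2 ->
    1 / 2 * expR (- N * (d0 / 2) ^+ 2) <= g x * expR (- N * x ^+ 2).
  move=> xd; apply: ler_pM; rewrite ?expR_ge0//.
    by apply: gd; lra.
  by rewrite -[x ^+ 2]real_normK ?num_real// hexp// [leRHS]ger0_norm//; lra.
set ed := expR (- N * d0 ^+ 2) in outer *.
set eh := expR (- N * (d0 / 2) ^+ 2) in inner *.
have ed0 : 0 <= M0 * ed by rewrite mulr_ge0 ?expR_ge0// ltW.
have sub a b x : -2 <= a -> b <= 2 -> a <= x <= b -> -2 <= x <= 2.
  by move=> a2 b2 /andP[ax xb]; apply/andP; split; lra.
(* The interval is cut at [-d0], [-d0/2], [d0/2] and [d0], one bound for each of the five pieces. *)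
have i1 : - (M0 * ed) * (- d0 - -2) <= G (- d0) - G (-2).
  apply: (@increment_ge (fun x => g x * expR (- N * x ^+ 2))) => [|x h|x h]; first lra.
    by apply: dG; apply: sub h; lra.
  have h2 : -2 <= x <= 2 by apply: sub h; lra.
  by apply: outer => //; rewrite ler0_norm; move: h => /andP[]; lra.
have i2 : 0 * (- (d0 / 2) - - d0) <= G (- (d0 / 2)) - G (- d0).
  apply: (@increment_ge (fun x => g x * expR (- N * x ^+ 2))) => [|x h|x h]; first lra.
    by apply: dG; apply: sub h; lra.
  by apply: middle; rewrite ler_norml; move: h => /andP[? ?]; apply/andP; split; lra.
have i3 : 1 / 2 * eh * (d0 / 2 - - (d0 / 2)) <= G (d0 / 2) - G (- (d0 / 2)).
  apply: (@increment_ge (fun x => g x * expR (- N * x ^+ 2))) => [|x h|x h]; first lra.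
    by apply: dG; apply: sub h; lra.
  by apply: inner; rewrite ler_norml.
have i4 : 0 * (d0 - d0 / 2) <= G d0 - G (d0 / 2).
  apply: (@increment_ge (fun x => g x * expR (- N * x ^+ 2))) => [|x h|x h]; first lra.
    by apply: dG; apply: sub h; lra.
  by apply: middle; rewrite ler_norml; move: h => /andP[? ?]; apply/andP; split; lra.
have i5 : - (M0 * ed) * (2 - d0) <= G 2 - G d0.
  apply: (@increment_ge (fun x => g x * expR (- N * x ^+ 2))) => [|x h|x h]; first lra.
    by apply: dG; apply: sub h; lra.
  have h2 : -2 <= x <= 2 by apply: sub h; lra.
  by apply: outer => //; rewrite ger0_norm; move: h => /andP[]; lra.
have ed1 : 0 <= M0 * ed * d0 by rewrite mulr_ge0// ltW.
move: i1 i2 i3 i4 i5; nra.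
Qed.

(** The two exponentials have ratio [expR (3 * N * d ^+ 2 / 4)]. The chosen [N] turns the exponent
    into [3 * M / d], and [1 + x <= expR x] suffices. *)
Lemma gaussian_mass_dominates (d M : R) : 0 < d <= 1 -> 0 < M ->
  exists2 N : R, 0 <= N &
    M * expR (- N * d ^+ 2) < d / 2 * expR (- N * (d / 2) ^+ 2).
Proof.
move=> /andP[d0 d1] M0; exists (4 * M / d ^+ 3) => [|].
  by rewrite divr_ge0 ?exprn_ge0// ?mulr_ge0// ltW.
set N := _ / _.
rewrite (_ : - N * (d / 2) ^+ 2 = - N * d ^+ 2 + 3 * M / d); last first.
  by rewrite /N; field; rewrite gt_eqF.
rewrite expRD [ltRHS]mulrCA [ltLHS]mulrC ltr_pM2l ?expR_gt0//.
have := expR_ge1Dx (3 * M / d) => h.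
apply: (@lt_le_trans _ _ (d / 2 * (1 + 3 * M / d))); last first.
  by rewrite ler_wpM2l// divr_ge0// ltW.
have -> : d / 2 * (1 + 3 * M / d) = d / 2 + 3 / 2 * M by field; rewrite gt_eqF.
lra.
Qed.

Lemma cr_differentiable_continuous (U V : R -> R -> R) :
  cr_differentiable U V ->
  (forall y, continuous (U^~ y)) /\ (forall x, continuous (U x)).
Proof.
move=> UV; split=> [y x|x y]; have [al [be h]] := UV x y;
    have [d d0 {}h] := h 1 ltr01.
- apply/cvgrPdist_le => e e0; near=> t.
  have td : `|t - x| <= d by near: t; apply/nbhs_ballP; exists d => //= z;
    rewrite /ball /= distrC => /ltW.
  have te : `|t - x| <= e / (`|al| + 1).
    near: t; apply/nbhs_ballP; exists (e / (`|al| + 1)) => /= [|z].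
      by rewrite divr_gt0 // ltr_wpDl.
    by rewrite /ball /= distrC => /ltW.
  have [] := h t y td; first by rewrite subrr normr0 ltW.
  rewrite !subrr normr0 mulr0 subr0 addr0 mul1r => hU _.
  rewrite distrC.
  have -> : U t y - U x y = U t y - (U x y + al * (t - x)) + al * (t - x) by ring.
  apply: le_trans (ler_normD _ _) _; rewrite normrM.
  apply: le_trans (lerD hU (lexx _)) _.
  by rewrite -[X in X + _]mul1r -mulrDl addrC mulrC -ler_pdivlMr ?ltr_wpDl// addrC.
- apply/cvgrPdist_le => e e0; near=> t.
  have td : `|t - y| <= d by near: t; apply/nbhs_ballP; exists d => //= z;
    rewrite /ball /= distrC => /ltW.
  have te : `|t - y| <= e / (`|be| + 1).
    near: t; apply/nbhs_ballP; exists (e / (`|be| + 1)) => /= [|z].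
      by rewrite divr_gt0 // ltr_wpDl.
    by rewrite /ball /= distrC => /ltW.
  have [] := h x t _ td; first by rewrite subrr normr0 ltW.
  rewrite !subrr normr0 mulr0 add0r addr0 mul1r => hU _.
  rewrite distrC.
  have -> : U x t - U x y = U x t - (U x y - be * (t - y)) - be * (t - y) by ring.
  apply: le_trans (ler_normB _ _) _; rewrite normrM.
  apply: le_trans (lerD hU (lexx _)) _.
  by rewrite -[X in X + _]mul1r -mulrDl addrC mulrC -ler_pdivlMr ?ltr_wpDl// addrC.
Unshelve. all: by end_near.
Qed.

(** Multiplication by [-i]: facts proved for the real part [U] carry over to the imaginary part
    [V]. *)
Lemma cr_differentiable_rot (U V : R -> R -> R) :
  cr_differentiable U V -> cr_differentiable V (fun x y => - U x y).
Proof.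
move=> UV x y; have [al [be h]] := UV x y.
exists be, (- al) => e e0; have [d d0 {}h] := h e e0.
exists d => // x' y' hx hy; have [h1 h2] := h x' y' hx hy; split.
  by rewrite mulNr opprK.
rewrite (_ : _ - _ = - (U x' y' - (U x y + al * (x' - x) - be * (y' - y)))).
  by rewrite normrN.
by ring.
Qed.

End RealEstimates.

(** * Entire functions *)

Section ComplexDerivative.
Variable R : realType.
Local Notation C := (R[i]).
Implicit Types (E f g : C -> C) (z w h : C).

Lemma complex_gt0 z : 0 < z -> exists2 r : R, 0 < r & z = r%:C.
Proof.
case: z => a b; rewrite ltcE /= => /andP[/eqP -> a0].
by exists a.
Qed.

Lemma normc_real (x : R) : `|x%:C| = `|x|%:C.
Proof. by rewrite normc_def /= expr0n addr0 sqrtr_sqr. Qed.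

Lemma norm_Re_le z (r : R) : `|z| <= r%:C -> `|complex.Re z| <= r.
Proof. by move=> zr; rewrite -lecR; exact: le_trans (normc_ge_Re z) zr. Qed.

Lemma norm_Im_le z (r : R) : `|z| <= r%:C -> `|complex.Im z| <= r.
Proof.
rewrite normc_def lecR; apply: le_trans.
by rewrite -[leLHS]sqrtr_sqr ler_wsqrtr// lerDr sqr_ge0.
Qed.

Lemma normc_le_add (a b : R) : `|a +i* b| <= (`|a| + `|b|)%:C.
Proof.
rewrite [_ +i* _](complexE (a +i* b)) /= rmorphD /=.
apply: le_trans (ler_normD _ _) _; rewrite normrM !normc_real lerD2l.
by rewrite normc_def /= expr0n expr1n add0r sqrtr1 mul1r.
Qed.

Lemma normc_ReIm_le z : `|z| <= (`|complex.Re z| + `|complex.Im z|)%:C.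
Proof. by case: z => a b; exact: normc_le_add. Qed.

(** A form without quotients, which admits [h = 0], and with real tolerances and radii, since a
    positive element of [C] is real. *)
Lemma derivable_epsP E z : derivable E z 1 <->
  exists D : C, forall e : R, 0 < e -> exists2 d : R, 0 < d &
    forall h, `|h| < d%:C -> `|E (z + h) - E z - D * h| <= e%:C * `|h|.
Proof.
split=> [dE|[D hD]].
- exists ('D_1 E z) => e e0.
  have eC : 0 < e%:C by rewrite ltcR.
  have /cvgrPdist_le/(_ _ eC) := dE.
  move=> /nbhs_ballP [r /= /complex_gt0 [d d0 ->] hr].
  exists d => // h hd; have [->|h0] := eqVneq h 0.
    by rewrite addr0 mulr0 subrr subr0 normr0 mulr0.
  have := hr h; rewrite /ball /= sub0r normrN => /(_ hd h0).
  rewrite [h *: _]mulr1 [h + z]addrC => /(ler_wpM2r (normr_ge0 h)).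
  apply: le_trans; rewrite -normrM -normrN opprB mulrBl.
  by rewrite [h^-1 *: _]mulrC divfK.
- apply/cvg_ex; exists D; apply/cvgrPdist_le => e /complex_gt0 [e' e0 ->].
  have [d d0 hd] := hD e' e0.
  apply/nbhs_ballP; exists d%:C; first by rewrite /= ltcR.
  move=> h; rewrite /ball /= sub0r normrN => /hd {}hd h0.
  rewrite [h *: _]mulr1 [h + z]addrC -(ler_pM2r (x := `|h|)) ?normr_gt0//.
  apply: le_trans hd; rewrite -normrM -[leRHS]normrN opprB mulrBl.
  by rewrite [h^-1 *: _]mulrC divfK.
Qed.

Definition entire E := forall z, derivable E z 1.

Lemma entire_cr E : entire E -> cr_differentiable
  (fun x y => complex.Re (E (x +i* y))) (fun x y => complex.Im (E (x +i* y))).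
Proof.
move=> dE x y; have /derivable_epsP [[al be] hD] := dE (x +i* y).
exists al, be => e e0; have [d d0 {}hD] := hD e e0.
(* A displacement with both coordinates at most [d / 3] has modulus at most [2 * d / 3 < d]. *)
exists (d / 3) => [|x' y' hx hy]; first lra.
have small : `|(x' - x) +i* (y' - y)| < d%:C.
  apply: le_lt_trans (normc_le_add _ _) _; rewrite ltcR; lra.
have := hD _ small; have -> : (x +i* y) + ((x' - x) +i* (y' - y)) = x' +i* y'.
  by apply/eqP; rewrite eq_complex /= !subrKC !eqxx.
move=> {}hD.
have {}hD : `|E (x' +i* y') - E (x +i* y) - (al +i* be) * ((x' - x) +i* (y' - y))|
   <= (e * (`|x' - x| + `|y' - y|))%:C.
  apply: le_trans hD _; rewrite [leRHS]rmorphM /= ler_wpM2l ?normc_le_add//.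
  by rewrite lecR ltW.
move: (norm_Re_le hD) (norm_Im_le hD).
case: (E (x' +i* y')) (E (x +i* y)) => [a b] [a' b'] /= h1 h2; split.
  by apply: le_trans h1; rewrite le_eqVlt; apply/orP; left; apply/eqP; congr `|_|; ring.
by apply: le_trans h2; rewrite le_eqVlt; apply/orP; left; apply/eqP; congr `|_|; ring.
Qed.

Lemma entireP E : entire E <-> forall z, differentiable E z.
Proof. by split=> h z; apply/derivable1_diffP; exact: h. Qed.

Lemma entireM f g : entire f -> entire g -> entire (fun z => f z * g z).
Proof. by move=> df dg z; exact: (derivableM (df z) (dg z)). Qed.

Lemma entireB f g : entire f -> entire g -> entire (fun z => f z - g z).
Proof. by move=> df dg z; exact: (derivableB (df z) (dg z)). Qed.

Lemma entireD f g : entire f -> entire g -> entire (fun z => f z + g z).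
Proof. by move=> df dg z; exact: (derivableD (df z) (dg z)). Qed.

Lemma entire_cst c : entire (fun=> c).
Proof. by move=> z; exact: derivable_cst. Qed.

Lemma entire_id : entire id.
Proof. by move=> z; exact: derivable_id. Qed.

Lemma entire_comp f g : entire f -> entire g -> entire (g \o f).
Proof.
move=> /entireP df /entireP dg; apply/entireP => z.
exact: differentiable_comp.
Qed.

Definition cexp z : C :=
  (expR (complex.Re z))%:C * (cos (complex.Im z) +i* sin (complex.Im z)).

Lemma cexpD z w : cexp (z + w) = cexp z * cexp w.
Proof.
case: z w => [a b] [c d]; apply/eqP; rewrite eq_complex /cexp /=.
by rewrite !(mul0r, mulr0, subr0, addr0, add0r) expRD cosD sinD;
  apply/andP; split; apply/eqP; ring.
Qed.

Lemma cexp_real (x : R) : cexp x%:C = (expR x)%:C.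
Proof. by rewrite /cexp /= cos0 sin0 mulr1. Qed.

Lemma norm_cexp z : `|cexp z| = (expR (complex.Re z))%:C.
Proof.
rewrite /cexp normrM normc_real (ger0_norm (expR_ge0 _)) normc_def /=.
by rewrite cos2Dsin2 sqrtr1 mulr1.
Qed.

Lemma is_derive_eps (u : R -> R) (x a : R) : is_derive x 1 u a ->
  forall e, 0 < e -> exists2 d : R, 0 < d &
    forall h : R, `|h| <= d -> `|u (x + h) - u x - a * h| <= e * `|h|.
Proof.
move=> [du <-] e e0; have /cvgrPdist_le/(_ _ e0) := du.
move=> /nbhs_ballP [r /= r0 hr].
exists (r / 2) => [|h hd]; first lra.
have [->|h0] := eqVneq h 0.
  by rewrite addr0 mulr0 subrr subr0 normr0 mulr0.
have := hr h; rewrite /ball /= sub0r normrN => /(_ ltac:(lra) h0).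
rewrite [h *: _]mulr1 [h + x]addrC => /(ler_wpM2r (normr_ge0 h)).
apply: le_trans; rewrite -normrM -normrN opprB mulrBl.
by rewrite [h^-1 *: _]mulrC divfK.
Qed.

(** Differentiability at 0 with derivative 1, assembled from the first-order expansions at 0 of
    [expR], [cos] and [sin]. *)
Lemma cexp_near0 (e : R) : 0 < e -> exists2 d : R, 0 < d &
  forall h, `|h| < d%:C -> `|cexp h - 1 - h| <= e%:C * `|h|.
Proof.
(* The errors on the real and imaginary parts come out as [4 * k] and [5 * k] times the modulus of
   [h], so [9 * k <= e] is enough. *)
move=> e0; pose k := Num.min 1 (e / 20).
have k0 : 0 < k by rewrite lt_min ltr01 divr_gt0.
have k1 : k <= 1 by rewrite ge_min lexx.
have ke : k <= e / 20 by rewrite ge_min lexx orbT.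
have [d1 d10 h1] := is_derive_eps (is_derive_expR (0 : R)) k0.
have [d2 d20 h2] := is_derive_eps (is_derive_cos (0 : R)) k0.
have [d3 d30 h3] := is_derive_eps (is_derive_sin (0 : R)) k0.
pose d := Num.min (Num.min d1 d2) (Num.min d3 k).
exists d; first by rewrite !lt_min d10 d20 d30 ltr01 divr_gt0.
move=> h hd.
have hsR := norm_Re_le (ltW hd); have htR := norm_Im_le (ltW hd).
have nRe : `|complex.Re h|%:C <= `|h| by exact: normc_ge_Re.
have nIm : `|complex.Im h|%:C <= `|h|.
  rewrite normc_def lecR -[leLHS]sqrtr_sqr ler_wsqrtr// lerDr.
  exact: sqr_ge0.
move: nRe nIm hsR htR; rewrite normc_sqrt_sqmod !lecR.
set nh := Num.sqrt _.
case: h hd @nh => [s t] hd nh /= ns nt hs ht.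
have dmin x : x <= d -> [/\ x <= d1, x <= d2, x <= d3 & x <= k].
  by rewrite !le_min => /andP[/andP[? ?] /andP[? ?]].
have [s1 s2 s3 sk] := dmin _ hs; have [t1 t2 t3 tk] := dmin _ ht.
have := h1 _ s1; have := h2 _ t2; have := h3 _ t3.
rewrite expR0 cos0 sin0 !add0r oppr0 mul0r !mul1r !subr0.
rewrite /cexp /= !(mul0r, mulr0, subr0, addr0, add0r).
set si := sin t; set co := cos t; set ex := expR s => hsi hco hex.
have ex3 : `|ex| <= 3.
  have -> : ex = (ex - 1 - s) + s + 1 by ring.
  apply: le_trans (ler_normD _ _) _; rewrite normr1.
  apply: le_trans (lerD (ler_normD _ _) (lexx _)) _.
  have : k * `|s| <= 1 * 1 by apply: ler_pM => //; [exact: ltW|exact: le_trans sk k1].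
  lra.
have bRe : `|ex * co - 1 - s| <= k * nh * 4.
  have -> : ex * co - 1 - s = (ex - 1 - s) + ex * (co - 1) by ring.
  apply: le_trans (ler_normD _ _) _; rewrite normrM.
  have := ler_pM (normr_ge0 _) (normr_ge0 _) ex3 hco.
  have := ler_wpM2l (ltW k0) ns; have := ler_wpM2l (ltW k0) nt; lra.
have bIm : `|ex * si - t| <= k * nh * 5.
  have -> : ex * si - t = (ex - 1 - s) * t + s * t + ex * (si - t) by ring.
  apply: le_trans (ler_normD _ _) _.
  apply: le_trans (lerD (ler_normD _ _) (lexx _)) _; rewrite !normrM.
  have := ler_pM (normr_ge0 _) (normr_ge0 _) ex3 hsi.
  have := ler_wpM2l (ltW k0) ns; have := ler_wpM2l (ltW k0) nt.
  have : `|ex - 1 - s| * `|t| <= k * `|s| * 1.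
    by apply: ler_pM => //; exact: le_trans tk k1.
  have : `|s| * `|t| <= k * `|t| by rewrite ler_wpM2r.
  lra.
have nh0 : 0 <= nh by exact: sqrtr_ge0.
apply: le_trans (normc_ReIm_le _) _.
rewrite -rmorphM lecR /= ?(subr0, oppr0, addr0).
have := ler_wpM2r nh0 ke; have := mulr_ge0 (ltW e0) nh0.
rewrite !mul0r subr0 addr0; move: bRe bIm; lra.
Qed.

(** The functional equation carries the estimate at 0 to [z]; the modulus [m] of the factor [cexp z]
    is absorbed into the tolerance. *)
Lemma entire_cexp : entire cexp.
Proof.
move=> z; apply/derivable_epsP; exists (cexp z) => e e0.
pose m := expR (complex.Re z).
have m0 : 0 < m by exact: expR_gt0.
have [d d0 hd] := cexp_near0 (divr_gt0 e0 m0).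
exists d => // h /hd {}hd.
rewrite cexpD; have -> : cexp z * cexp h - cexp z - cexp z * h
  = cexp z * (cexp h - 1 - h) by ring.
rewrite normrM norm_cexp; apply: le_trans (ler_wpM2l _ hd) _.
  by rewrite ler0c ltW.
by rewrite mulrA -(rmorphM (real_complex R)) /= mulrC mulrCA divff ?mulr1 ?gt_eqF// mulrC.
Qed.

End ComplexDerivative.

(** * Entire functions that vanish on the real line *)

Section Identity.
Variable R : realType.
Local Notation C := (R[i]).

(* The Gaussian kernel concentrates at 'i on the line of imaginary part 1; the
   contour is moved to the real line, where E vanishes. *)
Theorem entire_eq0_at_i (E : C -> C) : entire E ->
  (forall x : R, E x%:C = 0) -> E 'i = 0.
Proof.
move=> dE E0; apply/eqP; apply: contraT => Ei0.
(* Normalized to the value 1 at ['i], as [gaussian_mass] requires. *)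
pose f z := E z * (E 'i)^-1.
have df : entire f := entireM dE (@entire_cst R (E 'i)^-1).
have [fcx fcy] := cr_differentiable_continuous (entire_cr df).
have [_ gcy] := cr_differentiable_continuous (cr_differentiable_rot (entire_cr df)).
pose g x := complex.Re (f (x +i* 1)).
have g0 : g 0 = 1 by rewrite /g /f divff.
have [d [M [d01 M0 mass]]] := gaussian_mass (fcx 1) g0.
have side (x : R) : exists2 K : R, 0 < K & forall y : R, 0 <= y <= 1 ->
    `|f (x +i* y)| <= K%:C.
  have [K1 K10 h1] := bounded_on_segment ler01 (gcy x).
  have [K2 K20 h2] := bounded_on_segment ler01 (fcy x).
  exists (K1 + K2) => [|y y01]; first exact: addr_gt0.
  apply: le_trans (normc_ReIm_le _) _; rewrite lecR.
  by rewrite addrC lerD ?h1 ?h2.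
have [K1 K10 hK1] := side 2; have [K2 K20 hK2] := side (-2).
have M1 : 0 < M + K1 + K2 by rewrite !addr_gt0.
(* For this [N] the central mass on the line of imaginary part 1 exceeds the tails and both vertical
   sides together; Goursat's lemma will give the opposite inequality. *)
have [N N0 hN] := gaussian_mass_dominates d01 M1.
suff : d / 2 * expR (- N * (d / 2) ^+ 2) <= (M + K1 + K2) * expR (- N * d ^+ 2).
  by rewrite leNgt hN.
(* The second factor is the real Gaussian on the line of imaginary part 1. *)
pose W z := f z * cexp (- N%:C * (z - 'i) * (z - 'i)).
have dW : entire W.
  have dl : entire (fun z : C => z - 'i).
    exact: (entireB (@entire_id R) (@entire_cst R 'i)).
  have dq := entireM (entireM (@entire_cst R (- N%:C)) dl) dl.
  exact: (entireM df (entire_comp dq (@entire_cexp R))).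
pose U x y := complex.Re (W (x +i* y)); pose V x y := complex.Im (W (x +i* y)).
have [Ucx _] := cr_differentiable_continuous (entire_cr dW).
have [_ Vc] := cr_differentiable_continuous (cr_differentiable_rot (entire_cr dW)).
(* The primitives live on a rectangle strictly larger than the contour [[-2, 2] x [0, 1]]. *)
pose P y := sval (cid (@exists_primitive R (U^~ y) (-3) 3 (Ucx y))).
have dP (x y : R) : -3 < x < 3 -> is_derive x 1 (P y) (U x y).
  exact: (svalP (cid (@exists_primitive R (U^~ y) (-3) 3 (Ucx y)))).
pose Q x := sval (cid (@exists_primitive R (V x) (-1) 2 (Vc x))).
have dQ (x y : R) : -1 < y < 2 -> is_derive y 1 (Q x) (V x y).
  exact: (svalP (cid (@exists_primitive R (V x) (-1) 2 (Vc x)))).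
have : circulation P Q (-2) 2 0 1 = 0.
  by apply: (goursat (entire_cr dW) dP dQ); lra.
(* The bottom side contributes nothing, [E] being zero there. *)
have P0 : P 0 2 - P 0 (-2) = 0.
  have := @increment_near R (U^~ 0) (P 0) (-2) 2 0 0 ltac:(lra).
  rewrite !mul0r subr0 => h; apply/eqP; rewrite -normr_le0; apply: h => x /andP[? ?].
    by apply: dP; apply/andP; split; lra.
  rewrite /U /W /f (_ : x +i* 0 = x%:C)// E0 !mul0r /= subrr normr0.
  by [].
have sides (x : R) (K : R) : `|x| = 2 -> 0 < K ->
    (forall y : R, 0 <= y <= 1 -> `|f (x +i* y)| <= K%:C) ->
    `|Q x 1 - Q x 0| <= K * expR (- N * d ^+ 2).
  move=> x2 K0 hK.
  have := @increment_near R (V x) (Q x) 0 1 0 (K * expR (- N * d ^+ 2)) ler01.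
  rewrite mul0r !subr0 mulr1; apply.
    by move=> y /andP[? ?]; apply: dQ; apply/andP; split; lra.
  move=> y y01; rewrite subr0; apply: norm_Im_le; rewrite /W normrM rmorphM /=.
  apply: ler_pM => //; first exact: hK.
  rewrite norm_cexp lecR ler_expR /=.
  have x4 : x ^+ 2 = 4 by rewrite -real_normK ?num_real// x2; ring.
  (* On the vertical sides the exponent is at most [-3 * N], and [d <= 1]. *)
  rewrite [leLHS](_ : _ = - N * (4 - (y - 1) ^+ 2)); last by rewrite -x4; ring.
  rewrite !mulNr lerN2 ler_wpM2l//.
  move: d01 y01 => /andP[? ?] /andP[? ?]; nra.
have h1 := sides 2 K1 ltac:(by rewrite normr_nat) K10 hK1.
have h2 := sides (-2) K2 ltac:(by rewrite normrN normr_nat) K20 hK2.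
have := mass N (P 1) N0; rewrite /circulation => h3 h4.
have {}h3 : d / 2 * expR (- N * (d / 2) ^+ 2) - M * expR (- N * d ^+ 2)
      <= P 1 2 - P 1 (-2).
  apply: h3 => x /andP[x2 x2'].
  have -> : complex.Re (f (x +i* 1)) * expR (- N * x ^+ 2) = U x 1.
    rewrite /U /W.
    have -> : x +i* 1 - 'i = x%:C.
      by apply/eqP; rewrite eq_complex /= subr0 subrr !eqxx.
    rewrite -[- N%:C](rmorphN (real_complex R)) -!rmorphM /= cexp_real.
    case: (f _) => a b /=; rewrite mulr0 subr0; congr (_ * expR _); ring.
  by apply: dP; apply/andP; split; lra.
move: h1 h2 h3 h4 P0; rewrite !ler_norml => /andP[? ?] /andP[? ?]; lra.
Qed.

End Identity.

(** * The inner product of l2 *)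

Section InnerProduct.
Variable R : realType.
Local Notation C := (R[i]).
Implicit Types (x y z : l2 R) (a : C).

Lemma l2DE x y n : ((x : nat -> C) + (y : nat -> C)) n = x n + y n. Proof. by []. Qed.

Lemma l2ZE a x n : (a *: (x : nat -> C)) n = a * x n. Proof. by []. Qed.

(** The real part of the Hermitian product, defined by polarization so that it makes sense before
    the series of products is known to converge. *)
Definition rip x y : R := (l2sq (x + y) - l2sq x - l2sq y) / 2.

(** Polarization term by term reduces convergence to that of three sums of squares. *)
Lemma rip_cvg x y :
  series (fun n => complex.Re (x n * (y n)^*)) @ \oo --> rip x y.
Proof.
have -> : series (fun n => complex.Re (x n * (y n)^*)) = (2^-1 : R) *:
  (series (fun n => sqmod ((x + y) n)) - series (fun n => sqmod (x n))
    - series (fun n => sqmod (y n))).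
  apply/funext => n; rewrite /series /= -[RHS]/(2^-1 * (_ - _ - _)).
  rewrite -!sumrB mulr_sumr; apply: eq_bigr => k _.
  rewrite l2DE !sqmodE.
  by case: (x k) (y k) => [a b] [c d] /=; field.
rewrite /rip mulrC; apply: cvgZr.
by apply: cvgB; [apply: cvgB|]; exact: l2_cvg.
Qed.

(** By uniqueness of limits, identities for [rip] reduce to identities between partial sums. *)
Lemma rip_eq x y (s : nat -> R) (r : R) : s @ \oo --> r ->
  (forall n, \sum_(0 <= k < n) complex.Re (x k * (y k)^*) = s n) -> rip x y = r.
Proof.
move=> h e; rewrite -(cvg_lim (@Rhausdorff R) h).
rewrite -(cvg_lim (@Rhausdorff R) (@rip_cvg x y)).
by rewrite (_ : series _ = s)//; apply/funext => n; rewrite -e.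
Qed.

Lemma ripDl x y z : rip (x + y) z = rip x z + rip y z.
Proof.
apply: (rip_eq (cvgD (@rip_cvg x z) (@rip_cvg y z))) => n.
rewrite -[RHS]/(_ + _) -big_split /=.
apply: eq_bigr => k _; rewrite l2DE.
by case: (x k) (y k) (z k) => [a b] [c d] [e f] /=; ring.
Qed.

Lemma ripZl a x z : rip (a *: x) z = rip x (a^* *: z).
Proof.
apply: (rip_eq (@rip_cvg x (a^* *: z))) => n.
apply: eq_bigr => k _; rewrite /= !l2ZE.
by case: a (x k) (z k) => [a b] [c d] [e f] /=; ring.
Qed.

Lemma ripC x z : rip x z = rip z x.
Proof. by rewrite /rip [x + z]addrC; ring. Qed.

Lemma rip_id x : rip x x = l2sq x.
Proof.
rewrite /rip -mulr2n -scaler_nat l2sqZ.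
have -> : sqmod (2 : C) = 4 by rewrite sqmodE /=; ring.
by field.
Qed.

Lemma rip_realZ (t : R) x y : rip (t%:C *: x) y = t * rip x y.
Proof.
apply: (rip_eq (cvgM (cvg_cst t) (@rip_cvg x y))) => n.
rewrite -[RHS]/(_ * _) mulr_sumr.
apply: eq_bigr => k _; rewrite /= l2ZE.
by case: (x k) (y k) => [c d] [e f] /=; ring.
Qed.

Lemma ripNl x y : rip (- x) y = - rip x y.
Proof.
have -> : - x = (-1)%:C *: x by rewrite rmorphN /= scaleN1r.
by rewrite rip_realZ mulN1r.
Qed.

(** The Hermitian product, linear in [x]: its imaginary part is the real part of the product of [x]
    with ['i *: y]. *)
Definition ip x y : C := rip x y +i* rip x ('i *: y).

Lemma ipDl x y z : ip (x + y) z = ip x z + ip y z.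
Proof. by rewrite /ip !ripDl. Qed.

Lemma ripZr a x z : rip x (a *: z) = rip (a^* *: x) z.
Proof. by rewrite ripZl conjCK. Qed.

Lemma ipC x y : ip x y = (ip y x)^*.
Proof.
rewrite /ip /= ripC; congr (_ +i* _).
by rewrite ripZr conjCi scaleNr ripNl ripC.
Qed.

Lemma ipDr x y z : ip z (x + y) = ip z x + ip z y.
Proof. by rewrite ipC ipDl rmorphD [ip z x]ipC [ip z y]ipC. Qed.

Lemma ripZ (a b : R) x y :
  rip ((a +i* b) *: x) y = a * rip x y - b * rip x ('i *: y).
Proof.
have -> : a +i* b = a%:C + b%:C * 'i.
  by apply/eqP; rewrite eq_complex /=; apply/andP; split; apply/eqP; ring.
rewrite scalerDl ripDl -scalerA !rip_realZ; congr (_ + _).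
by rewrite ripZl conjCi scaleNr ripC ripNl ripC mulrN.
Qed.

Lemma ipZl a x y : ip (a *: x) y = a * ip x y.
Proof.
case: a => a b; rewrite /ip !ripZ scalerA.
have -> : ('i : C) * 'i = (-1)%:C.
  by apply/eqP; rewrite eq_complex /=; apply/andP; split; apply/eqP; ring.
rewrite [rip x ((-1)%:C *: y)]ripC rip_realZ [rip y x]ripC.
by apply/eqP; rewrite eq_complex /=; apply/andP; split; apply/eqP; ring.
Qed.

Lemma ipZr a x y : ip x (a *: y) = a^* * ip x y.
Proof. by rewrite ipC ipZl rmorphM [ip x y]ipC. Qed.

Lemma ip_id x : ip x x = `|x| ^+ 2.
Proof.
have : ip x x = (l2sq x)%:C.
  rewrite -rip_id; have := ipC x x; rewrite /ip => -[h].
  by rewrite (_ : rip x ('i *: x) = 0)//; lra.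
by move=> ->; rewrite l2_normE /l2norm -(rmorphXn (real_complex R)) sqr_sqrtr// l2sq_ge0.
Qed.

Lemma rip_normE x y :
  (rip x y)%:C = (`|x + y| ^+ 2 - `|x| ^+ 2 - `|y| ^+ 2) / 2.
Proof.
have e z : `|z| ^+ 2 = (l2sq z)%:C.
  by rewrite l2_normE /l2norm -(rmorphXn (real_complex R)) sqr_sqrtr// l2sq_ge0.
by rewrite !e /rip rmorphM /= (fmorphV (real_complex R))
  (rmorph_nat (real_complex R)) !rmorphB.
Qed.

Lemma cvg_sqr_norm (T : Type) (F : set_system T) (FF : Filter F) (f : T -> l2 R) x :
  f @ F --> x -> `|f t| ^+ 2 @[t --> F] --> `|x| ^+ 2.
Proof. by move=> fx; apply: cvgM; exact: cvg_norm. Qed.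

(** Joint continuity comes from continuity of the norm, through polarization. *)
Lemma cvg_rip (T : Type) (F : set_system T) (FF : Filter F) (f g : T -> l2 R) x y :
  f @ F --> x -> g @ F --> y -> (rip (f t) (g t))%:C @[t --> F] --> (rip x y)%:C.
Proof.
move=> fx gy.
rewrite (_ : (fun t => (rip (f t) (g t))%:C) = fun t =>
  (`|f t + g t| ^+ 2 - `|f t| ^+ 2 - `|g t| ^+ 2) / 2); last first.
  by apply/funext => t; exact: rip_normE.
rewrite rip_normE; apply: cvgMl; apply: cvgB; last exact: cvg_sqr_norm.
apply: cvgB; last exact: cvg_sqr_norm.
by apply: cvg_sqr_norm; exact: cvgD.
Qed.

Lemma cvg_ip (T : Type) (F : set_system T) (FF : Filter F) (f g : T -> l2 R) x y :
  f @ F --> x -> g @ F --> y -> ip (f t) (g t) @[t --> F] --> ip x y.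
Proof.
move=> fx gy.
have e u v : ip u v = (rip u v)%:C + 'i * (rip u ('i *: v))%:C.
  by apply/eqP; rewrite eq_complex /=; apply/andP; split; apply/eqP; ring.
rewrite (_ : (fun t => ip (f t) (g t)) = fun t =>
  (rip (f t) (g t))%:C + 'i * (rip (f t) ('i *: g t))%:C); last first.
  by apply/funext => t; exact: e.
rewrite e; apply: cvgD; first exact: cvg_rip.
by apply: cvgMr; apply: cvg_rip => //; exact: cvgZr.
Qed.

End InnerProduct.

(** * Polarization *)

Section Polarization.
Variable R : realType.
Local Notation C := (R[i]).

Lemma cvg_conj (T : Type) (F : set_system T) (FF : Filter F) (f : T -> C) (z : C) :
  f @ F --> z -> (f t)^* @[t --> F] --> z^*.
Proof.
move=> /cvgrPdist_le fz; apply/cvgrPdist_le => e e0.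
near=> t; rewrite -rmorphB norm_conjC; near: t; exact: fz.
Unshelve. all: by end_near.
Qed.

Lemma diff_quotientE (V : normedModType C) (x : C -> V) (z : C) :
  (fun h => h^-1 *: ((x \o shift z) (h *: 1) - x z)) =
  (fun h => h^-1 *: (x (h + z) - x z)).
Proof. by apply/funext => h; rewrite /= [h *: _]mulr1. Qed.

(** The product is antilinear in its second argument, and conjugating the parameter there restores
    holomorphy; the proof is Leibniz's rule. *)
Lemma entire_ip (x y : C -> l2 R) :
  (forall z, derivable x z 1) -> (forall z, derivable y z 1) ->
  entire (fun b => ip (x b) (y b^*)).
Proof.
move=> dx dy z.
have cy : {for z^*, continuous y}.
  by apply: differentiable_continuous; apply/derivable1_diffP.
pose qx h := h^-1 *: (x (h + z) - x z).
pose qy h := h^-1 *: (y (h + z^*) - y z^*).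
(* Pulling a scalar out of the second argument conjugates it, so the quotient of [y] is taken at the
   conjugate of [h]. *)
have qE h : h^-1 * (ip (x (h + z)) (y (h + z)^*) - ip (x z) (y z^*)) =
    ip (qx h) (y (h + z)^*) + ip (x z) (qy h^*).
  rewrite /qx /qy ipZl ipZr.
  have -> : ((h^*)^-1)^* = h^-1 by rewrite -fmorphV conjCK.
  rewrite -mulrDr.
  congr (_ * _).
  have subl (u v w : l2 R) : ip (u - v) w = ip u w - ip v w.
    by rewrite ipDl -scaleN1r ipZl mulN1r.
  have subr (u v w : l2 R) : ip w (u - v) = ip w u - ip w v.
    by rewrite ipDr -scaleN1r ipZr rmorphN rmorph1 mulN1r.
  by rewrite subl subr rmorphD /=; ring.
have hq : qx h @[h --> 0^'] --> 'D_1 x z.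
  by rewrite /qx -diff_quotientE; exact: dx.
have hq' : qy h @[h --> 0^'] --> 'D_1 y z^*.
  by rewrite /qy -diff_quotientE; exact: dy.
(* Conjugation preserves punctured neighbourhoods of 0. *)
have c0 : h^* @[h --> (0 : C)^'] --> (0 : C)^'.
  move=> A /nbhs_ballP [r /= r0 hr]; apply/nbhs_ballP; exists r => // h.
  rewrite /ball /= sub0r normrN => hh h0; apply: hr; last by rewrite fmorph_eq0.
  by rewrite /ball /= sub0r normrN norm_conjC.
have chz : (h + z)^* @[h --> (0 : C)^'] --> z^*.
  apply: cvg_conj; rewrite -[X in _ --> X]add0r.
  by apply: cvgD; [exact: cvg_within|exact: cvg_cst].
have hy : y (h + z)^* @[h --> (0 : C)^'] --> y z^*.
  exact: (continuous_cvg _ cy chz).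
have hqc : qy h^* @[h --> (0 : C)^'] --> 'D_1 y z^*.
  exact: (cvg_comp _ _ c0 hq').
have l1 := cvg_ip _ hq hy.
have l2 := cvg_ip _ (cvg_cst (x z)) hqc.
apply/cvg_ex; exists (ip ('D_1 x z) (y z^*) + ip (x z) ('D_1 y z^*)).
rewrite diff_quotientE.
have -> : (fun h => h^-1 *: (ip (x (h + z)) (y (h + z)^*) - ip (x z) (y z^*))) =
    (fun h => ip (qx h) (y (h + z)^*) + ip (x z) (qy h^*)).
  by apply/funext => h; exact: qE.
exact: cvgD (l1 _) (l2 _ _).
Qed.

(* The polarization of Phi. *)
Definition kernel (p q : C * C) : C :=
  cexp (p.1 * (q.1)^* / 4 - 'i / 4 * (p.2 - (q.2)^*)).

Lemma kernel_diag p : kernel p p = Phi p.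
Proof. by rewrite /kernel /Phi -normCK Phi_exponentE cexp_real. Qed.

Theorem polarization (F : C * C -> l2 R) : (forall p, differentiable F p) ->
  (forall p, `|F p| ^+ 2 = Phi p) -> forall p q, ip (F p) (F q) = kernel p q.
Proof.
move=> dF FPhi p q.
(* Chosen so that [m + b *: n] is [p] at [b = 'i] and [q] at its conjugate. *)
pose m : C * C := 2^-1 *: (p + q); pose n : C * C := (2 * 'i)^-1 *: (p - q).
have daff (b : C) : differentiable (fun b : C => m + b *: n) b.
  apply: differentiableD; first exact: differentiable_cst.
  apply: differentiableZl; exact: (proj1 (derivable1_diffP _ _) (@entire_id R b)).
have dl (b : C) : derivable (fun b : C => F (m + b *: n)) b 1.
  by apply/derivable1_diffP; exact: (differentiable_comp (daff b) (dF _)).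
(* The exponent of the kernel is expanded using the conjugates of [m] and [n], so that only [b]
   itself appears and holomorphy is visible. *)
have dE : entire (fun b => ip (F (m + b *: n)) (F (m + b^* *: n))
   - cexp ((m.1 + b * n.1) * ((m.1)^* + b * (n.1)^*) * 4^-1
      - 'i / 4 * ((m.2 + b * n.2) - ((m.2)^* + b * (n.2)^*)))).
  have aff (a c : C) : entire (fun b : C => a + b * c).
    exact: (entireD (@entire_cst R a) (entireM (@entire_id R) (@entire_cst R c))).
  apply: (entireB (entire_ip dl dl)).
  have dq := entireB (entireM (entireM (aff m.1 n.1) (aff (m.1)^* (n.1)^*))
       (@entire_cst R 4^-1))
    (entireM (@entire_cst R ('i / 4)) (entireB (aff m.2 n.2) (aff (m.2)^* (n.2)^*))).
  exact: (entire_comp dq (@entire_cexp R)).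
have := entire_eq0_at_i dE.
have conjE (u v b : C) : (u + b^* * v)^* = u^* + b * v^*.
  by rewrite rmorphD rmorphM /= conjCK.
have kE b : cexp ((m.1 + b * n.1) * ((m.1)^* + b * (n.1)^*) * 4^-1
      - 'i / 4 * ((m.2 + b * n.2) - ((m.2)^* + b * (n.2)^*)))
   = kernel (m + b *: n) (m + b^* *: n).
  by rewrite /kernel /= !conjE.
rewrite kE.
have i0 : 'i != 0 :> C by exact: neq0Ci.
have -> : m + 'i *: n = p.
  rewrite /m /n scalerA invfM mulrCA divff// mulr1 -scalerDr addrACA subrr addr0.
  by rewrite -mulr2n -(scaler_nat 2 p) scalerA mulVf ?scale1r// pnatr_eq0.
have -> : m + 'i^* *: n = q.
  rewrite /m /n conjCi scalerA invfM mulrCA mulNr divff// mulrN1 scaleNr -scalerBr.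
  rewrite opprB [q - p]addrC addrACA subrr add0r.
  by rewrite -mulr2n -(scaler_nat 2 q) scalerA mulVf ?scale1r// pnatr_eq0.
(* For real [b] both arguments coincide, and the difference vanishes by the hypothesis on the
   norm. *)
move=> h; apply/eqP; rewrite -subr_eq0; apply/eqP; apply: h => x.
have xx : (x%:C)^* = x%:C :> C by exact: conjc_real.
by rewrite kE xx ip_id FPhi kernel_diag subrr.
Qed.

Lemma Re_kernel_exponent (p q : C * C) :
  complex.Re (p.1 * (q.1)^* / 4 - 'i / 4 * (p.2 - (q.2)^*)) =
  (complex.Re p.1 * complex.Re q.1 + complex.Im p.1 * complex.Im q.1
    + complex.Im p.2 + complex.Im q.2) / 4.
Proof.
have -> : 4^-1 = (4^-1)%:C :> C.
  by rewrite (fmorphV (real_complex R)) (rmorph_nat (real_complex R)).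
by case: p q => [[a b] [c d]] [[a' b'] [c' d']] /=; field.
Qed.

(** Proportionality gives [|kernel p' p|^2 = kernel p' p' * kernel p p]. All three terms are real
    exponentials; in the exponents the contributions of [p.2] and [p'.2] cancel, leaving the squared
    distance from [p.1] to [p'.1]. *)
Lemma proportional_values (F : C * C -> l2 R) (p p' : C * C) (c : C) :
  (forall p q, ip (F p) (F q) = kernel p q) -> F p' = c *: F p -> p'.1 = p.1.
Proof.
move=> Fker Fc.
have h1 : kernel p' p = c * kernel p p by rewrite -!Fker Fc ipZl.
have h2 : kernel p' p' = c * (c^* * kernel p p).
  by rewrite -!Fker Fc ipZl ipZr.
have {h1 h2} : kernel p' p * (kernel p' p)^* = kernel p' p' * kernel p p.
  rewrite h2 h1 rmorphM /=.
  have -> : (kernel p p)^* = kernel p p.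
    by rewrite kernel_diag; exact: conjc_real.
  by ring.
rewrite -normCK norm_cexp !kernel_diag /Phi !Phi_exponentE /=.
rewrite Re_kernel_exponent -rmorphXn -rmorphM /=.
move=> /(@complexI R); rewrite -expRM_natl -expRD => /expR_inj.
rewrite !sqmodE; case: p p' {Fc} => [[a b] [e f]] [[a' b'] [e' f']] /= h.
have : (a' - a) ^+ 2 + (b' - b) ^+ 2 = 0 by lra.
move/eqP; rewrite paddr_eq0 ?sqr_ge0// !sqrf_eq0 !subr_eq0.
by move=> /andP[/eqP -> /eqP ->].
Qed.

End Polarization.

(** * The induced map *)

Section KahlerPotential.
Variable R : realType.
Local Notation C := (R[i]).
Implicit Types (p : C * C) (k w : C).

(** Along [(0, w)] the potential is an exact exponential, so differentiation multiplies it by a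
    constant. The factor [k] lets the rule be iterated for second derivatives. *)
Lemma dirD_vertical k w p : dirD (0, w) (fun q => k * Phi q) p
  = k * (complex.Im w / 2)%:C * Phi p.
Proof.
pose A := sqmod p.1 / 4 + complex.Im p.2 / 2.
have PhiE (t : R) : Phi (p + t%:C *: (0, w)) = (expR (A + complex.Im w / 2 * t))%:C.
  rewrite /Phi Phi_exponentE /A /= scaler0 addr0 -[t%:C *: w]/(t%:C * w).
  by congr (expR _)%:C; case: (p.2) w => [a b] [c d] /=; field.
have PhiE0 : Phi p = (expR A)%:C by rewrite /Phi Phi_exponentE.
have dexp (l : R) : is_derive (0 : R) 1 (fun t : R => l * expR (A + complex.Im w / 2 * t))
    (l * (complex.Im w / 2) * expR A).
  apply: is_derive_eq.
  rewrite mulr0 addr0 /GRing.scale /=; ring.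
have ReE : (fun t : R => complex.Re (k * Phi (p + t%:C *: (0, w)))) =
    (fun t : R => complex.Re k * expR (A + complex.Im w / 2 * t)).
  by apply/funext => t; rewrite PhiE; case: (k) => a b /=; ring.
have ImE : (fun t : R => complex.Im (k * Phi (p + t%:C *: (0, w)))) =
    (fun t : R => complex.Im k * expR (A + complex.Im w / 2 * t)).
  by apply/funext => t; rewrite PhiE; case: (k) => a b /=; ring.
rewrite /dirD ReE ImE !derive1E.
rewrite (@derive_val _ _ _ _ _ _ _ (dexp (complex.Re k))).
rewrite (@derive_val _ _ _ _ _ _ _ (dexp (complex.Im k))) PhiE0.
case: k {ReE ImE} => a b; apply/eqP; rewrite eq_complex /=.
by apply/andP; split; apply/eqP; ring.
Qed.

Lemma del_vertical k w : del (0, w) (fun q => k * Phi q)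
  = fun q => k * ((complex.Im w)%:C - 'i * (complex.Re w)%:C) / 4 * Phi q.
Proof.
apply/funext => p; rewrite /del.
have -> : 'i *: ((0, w) : C * C) = (0, 'i * w) by congr (_, _); exact: mulr0.
rewrite !dirD_vertical.
have -> : complex.Im ('i * w) = complex.Re w by case: (w) => a b /=; ring.
by rewrite !rmorphM /= (fmorphV (real_complex R)) (rmorph_nat (real_complex R)); field.
Qed.

Lemma delbar_vertical k w : delbar (0, w) (fun q => k * Phi q)
  = fun q => k * ((complex.Im w)%:C + 'i * (complex.Re w)%:C) / 4 * Phi q.
Proof.
apply/funext => p; rewrite /delbar.
have -> : 'i *: ((0, w) : C * C) = (0, 'i * w) by congr (_, _); exact: mulr0.
rewrite !dirD_vertical.
have -> : complex.Im ('i * w) = complex.Re w by case: (w) => a b /=; ring.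
by rewrite !rmorphM /= (fmorphV (real_complex R)) (rmorph_nat (real_complex R)); field.
Qed.

Lemma Phi_neq0 p : Phi p != 0.
Proof. by rewrite fmorph_eq0 gt_eqF// expR_gt0. Qed.

(** The value is [Phi p / 16]. One nonzero value of the form is what allows it to be cancelled when
    conformal factors are compared. *)
Lemma omega_tilde_neq0 p : omega_tilde p (0, 1) (0, 'i) != 0.
Proof.
have Phi1 : @Phi R = (fun q : C * C => 1 * Phi q) by apply/funext => q; rewrite mul1r.
rewrite /omega_tilde /kahler_form /deldelbar.
rewrite [X in delbar _ X]Phi1 [X in _ - del _ (delbar _ X) _]Phi1.
rewrite !delbar_vertical !del_vertical /=.
set P := Phi p.
have -> : 'i / 2 * (1 * (1%:C + 'i * 0%:C) / 4 * (0%:C - 'i * 1%:C) / 4 * P -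
    1 * (0%:C + 'i * 1%:C) / 4 * (1%:C - 'i * 0%:C) / 4 * P) = - ('i * 'i) / 16 * P :> C.
  by rewrite rmorph0 rmorph1; field.
rewrite mulf_neq0 ?Phi_neq0// mulf_neq0 ?invr_eq0 ?pnatr_eq0// oppr_eq0 mulf_neq0 ?neq0Ci//.
Qed.

End KahlerPotential.

(** * Injectivity domains of the two quotient maps *)

Section Charts.
Variable R : realType.
Local Notation C := (R[i]).

Lemma cvg_Re (T : Type) (F : set_system T) (FF : Filter F) (f : T -> C) (z : C) :
  f @ F --> z -> complex.Re (f t) @[t --> F] --> complex.Re z.
Proof.
move=> /cvgrPdist_le fz; apply/cvgrPdist_le => e e0.
have := fz e%:C; rewrite ltcR => /(_ e0); apply: filterS => t.
by move=> /norm_Re_le; case: (z) (f t) => [a b] [c d].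
Qed.

Lemma cvg_Im (T : Type) (F : set_system T) (FF : Filter F) (f : T -> C) (z : C) :
  f @ F --> z -> complex.Im (f t) @[t --> F] --> complex.Im z.
Proof.
move=> /cvgrPdist_le fz; apply/cvgrPdist_le => e e0.
have := fz e%:C; rewrite ltcR => /(_ e0); apply: filterS => t.
by move=> /norm_Im_le; case: (z) (f t) => [a b] [c d].
Qed.

Lemma pi_M_eqP (Gamma : groupClosed (heisR R)) (p q : C * C) :
  pi_M Gamma p = pi_M Gamma q <->
  exists2 a, a \in Gamma & real_coord q = (a * real_coord p)%g.
Proof.
split=> [/eqmodP/asboolP//|h].
by apply/eqmodP; apply/asboolP.
Qed.

Lemma pi_H_eqP (lambda : C) (x y : l2star R) : pi_H lambda x = pi_H lambda y <->
  exists2 k : int, lambda ^ k != 0 & l2star_val y = lambda ^ k *: l2star_val x.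
Proof.
split=> [/eqmodP/hopf_relP//|h].
by apply/eqmodP/hopf_relP.
Qed.

Lemma cvg_heis_div (T : Type) (F : set_system T) (FF : Filter F)
    (P Q : T -> C * C) (p : C * C) : P @ F --> p -> Q @ F --> p ->
  (real_coord (Q t) * (real_coord (P t))^-1)%g @[t --> F] --> (1%g : heisR R).
Proof.
move=> cP cQ; pose s : R := Num.sqrt 2.
(* The group quotient in coordinates, with squares written as products to match the limit lemmas
   used at the end. *)
pose D (P Q : C * C) : R * R * R * R :=
  (s * complex.Re Q.1 - s * complex.Re P.1,
   s * complex.Im Q.1 - s * complex.Im P.1,
   complex.Re Q.2 + complex.Re Q.1 * complex.Im Q.1
     + (s * complex.Re P.1 * (s * complex.Im P.1)
        - (complex.Re P.2 + complex.Re P.1 * complex.Im P.1))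
     - s * complex.Re Q.1 * (s * complex.Im P.1),
   complex.Im Q.2
     + (complex.Re Q.1 * complex.Re Q.1 + complex.Im Q.1 * complex.Im Q.1) / 2
     - (complex.Im P.2
        + (complex.Re P.1 * complex.Re P.1 + complex.Im P.1 * complex.Im P.1) / 2)).
have -> : (fun t => (real_coord (Q t) * (real_coord (P t))^-1)%g)
    = (fun t => D (P t) (Q t)).
  apply/funext => t; case: (P t) (Q t) => [[a b] [c d]] [[a' b'] [c' d']].
  by congr (_, _, _, _); rewrite mulrN.
have -> : (1%g : heisR R) = D p p by congr (_, _, _, _) => /=; ring.
have cP1 : (P t).1 @[t --> F] --> p.1 by exact: (cvg_comp _ _ cP cvg_fst).
have cP2 : (P t).2 @[t --> F] --> p.2 by exact: (cvg_comp _ _ cP cvg_snd).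
have cQ1 : (Q t).1 @[t --> F] --> p.1 by exact: (cvg_comp _ _ cQ cvg_fst).
have cQ2 : (Q t).2 @[t --> F] --> p.2 by exact: (cvg_comp _ _ cQ cvg_snd).
have ReP1 := cvg_Re FF cP1; have ImP1 := cvg_Im FF cP1.
have ReP2 := cvg_Re FF cP2; have ImP2 := cvg_Im FF cP2.
have ReQ1 := cvg_Re FF cQ1; have ImQ1 := cvg_Im FF cQ1.
have ReQ2 := cvg_Re FF cQ2; have ImQ2 := cvg_Im FF cQ2.
have cs : s @[t --> F] --> s by exact: cvg_cst.
have ch : (2^-1 : R) @[t --> F] --> (2^-1 : R) by exact: cvg_cst.
apply: (cvg_pair (cvg_pair (cvg_pair
  (cvgB (cvgM cs ReQ1) (cvgM cs ReP1)) (cvgB (cvgM cs ImQ1) (cvgM cs ImP1)))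
  (cvgB (cvgD (cvgD ReQ2 (cvgM ReQ1 ImQ1))
    (cvgB (cvgM (cvgM cs ReP1) (cvgM cs ImP1)) (cvgD ReP2 (cvgM ReP1 ImP1))))
    (cvgM (cvgM cs ReQ1) (cvgM cs ImP1))))
  (cvgB (cvgD ImQ2 (cvgM (cvgD (cvgM ReQ1 ReQ1) (cvgM ImQ1 ImQ1)) ch))
    (cvgD ImP2 (cvgM (cvgD (cvgM ReP1 ReP1) (cvgM ImP1 ImP1)) ch)))).
Qed.

(** If [q] and [q'] are close to [p] and [a] in [Gamma] carries one to the other, then [a] is their
    quotient, hence close to 1, hence 1 by discreteness. *)
Lemma exists_injective_nbhs (Gamma : groupClosed (heisR R)) (p : C * C) :
  [set` Gamma] `<=` isolated [set` Gamma] ->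
  exists2 U, open_nbhs p U & {in U &, injective (pi_M Gamma)}.
Proof.
move=> discrete.
have [|_ [N N1 NG]] := discrete 1%g; first exact: gpred1.
have : \forall q \near (p, p), N (real_coord q.2 * (real_coord q.1)^-1)%g.
  have := @cvg_heis_div _ (nbhs (p, p)) _ fst snd p cvg_fst cvg_snd; exact.
move=> [[A B] /= [Ap Bp] AB].
have : nbhs p (A `&` B) by exact: filterI.
rewrite nbhsE => -[U pU UAB]; exists U => // q q' /set_mem Uq /set_mem Uq'.
move=> /pi_M_eqP [a aG e].
have : N a.
  have -> : a = (real_coord q' * (real_coord q)^-1)%g by rewrite e mulgK.
  by apply: (AB (q, q')); split; [have [] := UAB _ Uq|have [] := UAB _ Uq'].
move=> Na; have : (N `&` [set` Gamma]) a by split.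
rewrite NG /= => a1; move: e; rewrite a1 mul1g => e.
by rewrite -(real_coordK q) -(real_coordK q') e.
Qed.

(** The norm takes values in [C]; a real-valued copy is needed for intervals and order arguments. *)
Definition l2_rnorm (x : l2 R) : R := complex.Re `|x|.

Lemma l2_rnormE (x : l2 R) : `|x| = (l2_rnorm x)%:C.
Proof. by []. Qed.

(** A nonzero power of [lambda] changes the norm by a factor of at least [M] or at most [1 / M],
    where [M > 1] is the modulus of [lambda] or its inverse. An open shell with ratio [M] between
    its radii therefore meets each orbit at most once. *)
Lemma exists_norm_shell (lambda : C) (m : R) : lambda != 0 -> `|lambda| != 1 ->
  0 < m -> exists m1 m2, [/\ m1 < m, m < m2 &
   forall (x y : l2 R) (k : int), m1 < l2_rnorm x < m2 -> m1 < l2_rnorm y < m2 ->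
     y = lambda ^ k *: x -> y = x].
Proof.
move=> l0 l1 m0.
pose L := complex.Re `|lambda|.
have LE : `|lambda| = L%:C by rewrite /L normc_def.
have L0 : 0 < L by rewrite -ltcR -LE normr_gt0.
have L1 : L != 1 by apply: contra_neq l1 => L1; rewrite LE L1.
have [M [M1 ML]] : exists M, 1 < M /\ (M = L \/ M * L = 1 /\ L <= 1).
  have [L1'|L1'] := ltP 1 L; first by exists L; split => //; left.
  exists L^-1; split; last by right; rewrite mulVf ?gt_eqF.
  by rewrite invf_gt1// lt_neqAle L1.
have M0 : 0 < 1 + M by lra.
(* Since [2 / (1 + M) < 1 < 2 * M / (1 + M)], the norm [m] lies strictly between [m1] and
   [M * m1]. *)
pose m1 := 2 * m / (1 + M).
have m10 : 0 < m1 by rewrite divr_gt0// mulr_gt0.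
exists m1, (M * m1); split.
- by rewrite ltr_pdivrMr//; nra.
- by rewrite mulrA ltr_pdivlMr//; nra.
have shell (x y : l2 R) n : m1 < l2_rnorm x < M * m1 ->
    m1 < l2_rnorm y < M * m1 -> y = lambda ^+ n *: x -> n = 0%N.
  move=> /andP[x1 x2] /andP[y1 y2] e.
  have nE : l2_rnorm y = L ^+ n * l2_rnorm x.
    apply: (@complexI R); rewrite rmorphM rmorphXn /= -!l2_rnormE e normrZ.
    by rewrite normrX LE.
  case: n e nE => // n _ nE; exfalso.
  case: ML => [ML|[ML L1']].
    have : L <= L ^+ n.+1 by rewrite -[leLHS]expr1 ler_weXn2l// -ML ltW.
    rewrite -ML in nE *; move: nE y2 x1 m10 M1; nra.
  have : L ^+ n.+1 <= L by rewrite -[leRHS]expr1 ler_wiXn2l// ltW.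
  have : l2_rnorm x = M * L * l2_rnorm x by rewrite ML mul1r.
  move: nE y1 x2 m10 M1; nra.
move=> x y [n|n] hx hy.
  by rewrite -exprnP => e; rewrite e (shell _ _ _ hx hy e) expr0 scale1r.
(* A negative power exchanges the roles of [x] and [y]. *)
rewrite NegzE -exprnN => e.
suff /(shell _ _ _ hy hx) : x = lambda ^+ n.+1 *: y by [].
by rewrite e scalerA divff ?scale1r// expf_neq0.
Qed.

(** The set [V] is taken in [l2 R] so that its preimage under [F] is open by continuity of [F]. *)
Lemma exists_injective_shell (lambda : C) (x0 : l2star R) :
  lambda != 0 -> `|lambda| != 1 ->
  exists2 V : set (l2 R), open V /\ V (l2star_val x0) &
    {in (@l2star_val R) @^-1` V &, injective (pi_H lambda)}.
Proof.
move=> l0 l1.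
have m0 : 0 < l2_rnorm (l2star_val x0).
  by rewrite -ltcR -l2_rnormE normr_gt0 l2star_neq0.
have [m1 [m2 [h1 h2 inj]]] := exists_norm_shell l0 l1 m0.
have cn : continuous l2_rnorm.
  move=> x; exact: (cvg_Re (nbhs_filter x) (@norm_continuous _ (l2 R) x)).
exists (l2_rnorm @^-1` `]m1, m2[).
  split; last by rewrite /= in_itv /= h1 h2.
  by apply: open_comp => [x _|]; [exact: cn|exact: interval_open].
move=> x y /set_mem/= + /set_mem/=; rewrite !in_itv /= => hx hy /pi_H_eqP [k _ e].
by apply/val_inj; apply/esym; exact: inj e.
Qed.

End Charts.

(** * The conformal factor and the lattice *)

Section Obstruction.
Variable R : realType.
Local Notation C := (R[i]).

(** Near each point the lift [F'] is itself a chart expression of [f]. The lcK condition then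
    equates two multiples of [omega_tilde], with factors the inverses of [|F p|^2] and [Phi p]. *)
Lemma lck_norm_eq_Phi (F : C * C -> l2 R) (Gamma : groupClosed (heisR R))
    (lambda : C) (f : kodaira Gamma -> hopf lambda) :
  kahler_map F -> [set` Gamma] `<=` isolated [set` Gamma] ->
  lambda != 0 -> `|lambda| != 1 -> lck_map f -> induces F f ->
  forall p, `|F p| ^+ 2 = Phi p.
Proof.
move=> [dF Fform] discrete l0 l1 [_ lck] [F' [FE fE]] p.
have [U [oU Up] Uinj] := exists_injective_nbhs p discrete.
have [V [oV Vp] Vinj] := exists_injective_shell (F' p) l0 l1.
pose W := U `&` F @^-1` V.
have oW : open W.
  apply: openI => //; apply: open_comp => // x _.
  exact: differentiable_continuous.
have Wp : W p by split => //=; rewrite FE.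
have chart : chart_expr f W (@l2star_val R @^-1` V) F'.
  split => //.
  - by move=> x y /set_mem [Ux _] /set_mem [Uy _]; apply: Uinj; apply/mem_set.
  - by exists V.
  - move=> q [_ Vq]; split; first by move: Vq; rewrite /= FE.
    by have := congr1 (fun g => g q) fE.
have := lck _ _ _ chart p (0, 1) (0, 'i) Wp.
rewrite -FE /pullback /omega_hopf /omega_kodaira.
have := Fform p (0, 1) (0, 'i); rewrite /pullback => ->.
by move/(mulIf (omega_tilde_neq0 p))/invr_inj.
Qed.

Definition heis_x (g : heisR R) : R := g.1.1.1.

(** Otherwise the coordinate [x] would be invariant under [Gamma] and descend to an unbounded
    continuous function on a compact space. *)
Lemma lattice_noncentral (Gamma : groupClosed (heisR R)) : lattice Gamma ->
  exists2 a, a \in Gamma & heis_x a != 0.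
Proof.
move=> [_ cptM]; apply: contrapT => none.
have x0 a : a \in Gamma -> heis_x a = 0.
  by move=> aG; apply: contrapT => /eqP a0; apply: none; exists a.
have cx : continuous heis_x.
  move=> [[[x y] t] u].
  exact: (cvg_comp _ _ (cvg_comp _ _ cvg_fst cvg_fst) cvg_fst).
have xM (a g : heisR R) : heis_x (a * g)%g = heis_x a + heis_x g.
  by case: a g => [[[x y] t] u] [[[x' y'] t'] u'].
have xinv : {homo heis_x : a b / \pi_(kodaira Gamma) a == \pi_(kodaira Gamma) b >-> a == b}.
  move=> a b /eqP /eqmodP /asboolP [c cG ->].
  by rewrite xM (x0 c cG) add0r.
(* The descended function is [heis_x] on chosen representatives; by [xinv] the choice does not
   affect the value. *)
have cxM : continuous (heis_x \o repr : kodaira Gamma -> R).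
  exact: repr_comp_continuous.
have := continuous_compact (continuous_subspaceT cxM) cptM.
move=> /compact_bounded /pinfty_ex_gt0 [M M0 hM].
have xrepr (g : heisR R) : heis_x (repr (\pi_(kodaira Gamma) g)) = heis_x g.
  by apply/eqP; apply: xinv; rewrite reprK.
have : `|heis_x (repr (\pi_(kodaira Gamma) ((M + 1, 0, 0, 0) : heisR R)))| <= M.
  by apply: hM; exists (\pi_(kodaira Gamma) ((M + 1, 0, 0, 0) : heisR R)).
by rewrite xrepr /heis_x /= ger0_norm; lra.
Qed.

End Obstruction.

Theorem corollary4p7 (R : realType) (F : R[i] * R[i] -> l2 R)
    (Fkahler : kahler_map F)
    (Gamma : groupClosed (heisR R)) (Gamma_lattice : lattice Gamma)
    (lambda : R[i]) (lambda_neq0 : lambda != 0) (lambda_norm : `|lambda| != 1) :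
  ~ exists f : kodaira Gamma -> hopf lambda, lck_map f /\ induces F f.
Proof.
move=> [f [lckf indf]].
have FPhi := lck_norm_eq_Phi Fkahler Gamma_lattice.1 lambda_neq0 lambda_norm lckf indf.
have Fker := polarization Fkahler.1 FPhi.
have [a aG] := lattice_noncentral Gamma_lattice.
case: indf => F' [FE fE]; apply/negP; rewrite negbK.
(* The identity and [a] lie in one orbit, so the values of [F] there differ by a power of
   [lambda]. *)
have piM : pi_M Gamma (holo_coord 1%g) = pi_M Gamma (holo_coord a).
  by apply/pi_M_eqP; exists a => //; rewrite !holo_coordK mulg1.
have : pi_H lambda (F' (holo_coord 1%g)) = pi_H lambda (F' (holo_coord a)).
  have e q : f (pi_M Gamma q) = pi_H lambda (F' q) by have := congr1 (fun g => g q) fE.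
  by rewrite -!e piM.
move=> /pi_H_eqP [k _ Fa].
have : F (holo_coord a) = lambda ^ k *: F (holo_coord 1%g) by rewrite FE.
(* The first holomorphic coordinate has real part [x / Num.sqrt 2]; its equality with the value 0 at
   the identity forces [x = 0]. *)
move=> /(proportional_values Fker) /(congr1 (@complex.Re R)).
case: a {aG piM Fa} => [[[x y] t] u] /=; rewrite mul0r /heis_x /= => /eqP.
by rewrite mulf_eq0 invr_eq0 sqrtr_eq0 lern0 orbF.
Qed.
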